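(* For any $d\in\mathbb{N}^*$, $R>0$, $M>0$ there is $C>0$ such that the following holds. Let $\mu,\nu$ be probability measures on $\mathbb{R}^d$ compactly supported in $B_R$ such that $\mu(A)\le M\lambda(A)$ for any measurable set $A\subset\mathbb{R}^d$. Let $\bar\varphi$ be an $R$-Lipschitz optimal Brenier potential for $(\mu,\nu)$. For any probability measures $\hat\mu,\hat\nu$ supported on $B_R$ and any $\phi_0\in\Gamma_0(\mathbb{R}^d)$ which is an optimal Brenier potential for $(\hat\mu,\hat\nu)$ and is $2R$-Lipschitz on $B_{2R}$, we have $$\int_{\mathbb{R}^d}\|\nabla\bar\varphi(x)-\nabla\phi_0(x)\|\,d\mu(x)\le C\left(W_1(\mu,\hat\mu)+W_1(\nu,\hat\nu)\right)^{\frac14}.$$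
   Context: $B_R$ is the open Euclidean ball of $\mathbb{R}^d$ centered at $0$ with radius $R$; $\lambda$ is the Lebesgue measure. $\Gamma_0(\mathbb{R}^d)$ is the set of proper lower semicontinuous convex functions $\mathbb{R}^d\to\mathbb{R}\cup\{+\infty\}$; $\varphi^*(y)=\sup_{x}\langle x,y\rangle-\varphi(x)$. An optimal Brenier potential for a pair $(\alpha,\beta)$ of compactly supported probability measures on $\mathbb{R}^d$ is a function $\varphi\in\Gamma_0(\mathbb{R}^d)$ attaining the infimum $\inf_{\varphi\in\Gamma_0(\mathbb{R}^d)}\int\varphi\,d\alpha+\int\varphi^*\,d\beta$. $W_1$ is the 1-Wasserstein distance for the Euclidean norm. The gradients are defined Lebesgue-almost everywhere on the interior of the domains, hence $\mu$-almost everywhere. *)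

(* Defs.v *)
From HB Require Import structures.
From mathcomp Require Import all_boot all_order all_algebra.
From mathcomp Require Import all_classical all_reals all_analysis.

Set Implicit Arguments.
Unset Strict Implicit.
Unset Printing Implicit Defensive.

Import Order.TTheory GRing.Theory Num.Theory.
Import numFieldNormedType.Exports.

Local Open Scope classical_set_scope.
Local Open Scope ring_scope.

(* Row vectors with their Borel sigma-algebra. The library norm `|x| on
   'rV[R]_d is the sup norm: it induces the usual topology, but every metric
   notion below goes through the Euclidean norm enorm. *)
Notation Rd R d := (g_sigma_algebraType (@open ('rV[R]_d))).

Section euclidean.
Context {R : realType} {d : nat}.
Implicit Types (x y : 'rV[R]_d).

Definition dot x y : R := \sum_(i < d) x ord0 i * y ord0 i.

Definition enorm x : R := Num.sqrt (dot x x).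

Definition eball (r : R) : set 'rV[R]_d := [set x | enorm x < r].

(* Where a partial derivative does not exist, 'D returns a default value; for
   convex functions this is a Lebesgue-null set in the interior of the domain. *)
Definition grad (f : 'rV[R]_d -> R) x : 'rV[R]_d :=
  \row_(i < d) 'D_(delta_mx ord0 i) f x.

(* Being Lipschitz on A includes being finite on A. *)
Definition elipschitz (L : R) (A : set 'rV[R]_d) (phi : 'rV[R]_d -> \bar R) :=
  (forall x, A x -> phi x \is a fin_num) /\
  (forall x y, A x -> A y ->
     `|fine (phi x) - fine (phi y)| <= L * enorm (x - y)).

End euclidean.

(* The d-fold product of the one-dimensional Lebesgue measure, as an iterated
   integral over sections; it is the Lebesgue measure on Borel sets (Tonelli),
   and is not meant to be used on other sets. *)
Fixpoint lebesgue_rV {R : realType} (d : nat) : set 'rV[R]_d -> \bar R :=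
  match d return set 'rV[R]_d -> \bar R with
  | 0 => fun A => (\1_A (0 : 'rV[R]_0))%:E
  | k.+1 => fun A =>
      (\int[lebesgue_measure]_(t in [set: R])
         lebesgue_rV [set y : 'rV[R]_k | A (row_mx (const_mx t : 'rV[R]_1) y)])%E
  end.

Section convex_analysis.
Context {R : realType} {d : nat}.
Implicit Types (phi : 'rV[R]_d -> \bar R).
Local Open Scope ereal_scope.

Definition proper_fun phi :=
  (forall x, phi x != -oo) /\ (exists x, phi x != +oo).

Definition econvex phi := forall (x y : 'rV[R]_d) (t : R),
  (0 < t < 1)%R ->
  phi (t *: x + (1 - t) *: y)%R <= t%:E * phi x + (1 - t)%:E * phi y.

Definition Gamma0 : set ('rV[R]_d -> \bar R) :=
  [set phi | [/\ proper_fun phi, lower_semicontinuous phi & econvex phi]].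

Definition conjugate phi : 'rV[R]_d -> \bar R :=
  fun y => ereal_sup [set (dot x y)%:E - phi x | x in [set: 'rV[R]_d]].

End convex_analysis.

Section transport.
Context {R : realType} {d : nat}.
Implicit Types (alpha beta : probability (Rd R d) R).
Implicit Types (phi : 'rV[R]_d -> \bar R).
Local Open Scope ereal_scope.

Definition msupport alpha : set 'rV[R]_d :=
  [set x | forall U : set 'rV[R]_d, open U -> U x -> 0 < alpha U].

Definition brenier_functional alpha beta phi : \bar R :=
  \int[alpha]_x phi x + \int[beta]_y conjugate phi y.

Definition optimal_brenier_potential alpha beta phi :=
  Gamma0 phi /\
  brenier_functional alpha beta phi =
    ereal_inf [set brenier_functional alpha beta psi | psi in Gamma0].

Definition couplings alpha beta : set (probability (Rd R d * Rd R d)%type R) :=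
  [set pi | (forall A : set (Rd R d), measurable A ->
               pushforward pi fst A = alpha A) /\
            (forall A : set (Rd R d), measurable A ->
               pushforward pi snd A = beta A)].

Definition wasserstein1 alpha beta : \bar R :=
  ereal_inf [set \int[pi]_z (enorm ((z.1 : 'rV[R]_d) - z.2))%:E
            | pi in couplings alpha beta].

End transport.

(* Main.v *)
Require Import Defs.
From HB Require Import structures.
From mathcomp Require Import all_boot all_order all_algebra.
From mathcomp Require Import all_classical all_reals all_analysis.
From mathcomp Require Import measurable_realfun.
From mathcomp Require Import ring lra.
Import Order.TTheory GRing.Theory Num.Theory.
Import numFieldNormedType.Exports.
Local Open Scope classical_set_scope.
Local Open Scope ring_scope.

(** Let [f] and [g] be the real functions underlying [phibar] and [phi0], let
    [p] and [q] be the conjugates of [f] and [g] restricted to a closed ball of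
    radius [rho] with [r < rho < 2 * r], and let [w] be the sum of the two
    Wasserstein distances. On measures carried by the ball of radius [r],
    restricting to that larger ball can only lower the dual functional, so
    truncated potentials are still optimal, and now [f], [g], [p] and [q] are
    all Lipschitz.

    Since [g] is optimal for the perturbed pair and everything is Lipschitz,
    using [g] instead of [f] for the pair [(mu, nu)] raises the functional by
    at most [3 * r * w] ([duality_gap]). Conversely [f] is optimal for
    [(mu, nu)]; test it against the conjugate of [(p + q) / 2]. The value at
    [x] of this competitor is at most [(f (x - v) + g (x + v)) / 2] for every
    [v] ([optimality_midpoint]). Choosing at each [x] the better of the two
    vectors [v = h e_i] and [v = - h e_i], these two facts give
    [[
      \int max_v (f x + g x - f (x - v) - g (x + v)) dmu(x) <= 3 * r * w.
    ]]
    To first order in [h] the integrand is [h] times the absolute difference of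
    the i-th partial derivatives of [f] and [g], and by convexity the error is
    at most the sum of the second differences of [f] and [g] with step [h]
    ([partial_gap]).

    On a line, the integral of a second difference with step [h] telescopes to
    [O(h ^ 2)] for a Lipschitz function ([integral_second_difference]); as [mu]
    has a bounded density, Fubini along the i-th axis extends this to [mu]
    ([integral_sdiff_le]). The same estimate shows that partial derivatives
    exist almost everywhere ([derivable_off_null]). Hence the integral to bound
    is [O(w / h + h)] for all small [h]. The step [h = sqrt w] gives the power
    [1 / 2] of [w] when [w] is small, and the trivial bound on gradients takes
    care of large [w] ([optimize_step]). *)

(** * Euclidean geometry and Lipschitz functions *)

Section euclidean_facts.
Context {R : realType} {d : nat}.
Implicit Types (x y z : 'rV[R]_d).

Lemma dotC x y : dot x y = dot y x.
Proof. by apply: eq_bigr => i _; rewrite mulrC. Qed.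

Lemma dotDl x y z : dot (x + y) z = dot x z + dot y z.
Proof. by rewrite -big_split; apply: eq_bigr => i _; rewrite mxE mulrDl. Qed.

Lemma dotZl a x y : dot (a *: x) y = a * dot x y.
Proof. by rewrite mulr_sumr; apply: eq_bigr => i _; rewrite mxE mulrA. Qed.

Lemma dotNl x y : dot (- x) y = - dot x y.
Proof. by rewrite -scaleN1r dotZl mulN1r. Qed.

Lemma dotDr x y z : dot z (x + y) = dot z x + dot z y.
Proof. by rewrite dotC dotDl !(dotC z). Qed.

Lemma dotZr a x y : dot y (a *: x) = a * dot y x.
Proof. by rewrite dotC dotZl (dotC y). Qed.

Lemma dot_ge0 x : 0 <= dot x x.
Proof. by apply: sumr_ge0 => i _; rewrite -expr2 sqr_ge0. Qed.

Lemma dot0l x : dot 0 x = 0.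
Proof. by apply: big1 => i _; rewrite mxE mul0r. Qed.

Lemma enorm_ge0 x : 0 <= enorm x.
Proof. exact: sqrtr_ge0. Qed.

Lemma enorm_sqr x : enorm x ^+ 2 = dot x x.
Proof. by rewrite sqr_sqrtr // dot_ge0. Qed.

Lemma abs_coord_le_enorm x i : `|x ord0 i| <= enorm x.
Proof.
rewrite -sqrtr_sqr; apply: ler_wsqrtr; rewrite /dot (bigD1 i) //= -expr2.
by rewrite lerDl; apply: sumr_ge0 => j _; rewrite -expr2 sqr_ge0.
Qed.

Lemma enorm_eq0 x : enorm x = 0 -> x = 0.
Proof.
move=> x0; apply/rowP => i; rewrite mxE; apply/eqP.
by rewrite -normr_le0 -x0 abs_coord_le_enorm.
Qed.

Lemma dot_le_enorm x y : dot x y <= enorm x * enorm y.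
Proof.
have [/enorm_eq0 ->|x0] := eqVneq (enorm x) 0.
  by rewrite dot0l mulr_ge0 ?enorm_ge0.
have [/enorm_eq0 ->|y0] := eqVneq (enorm y) 0.
  by rewrite dotC dot0l mulr_ge0 ?enorm_ge0.
(* This vector has squared norm 2 |x| |y| (|x| |y| - <x, y>). *)
have := dot_ge0 (enorm y *: x + (- enorm x) *: y).
have xp : 0 < enorm x by rewrite lt_neqAle eq_sym x0 enorm_ge0.
have yp : 0 < enorm y by rewrite lt_neqAle eq_sym y0 enorm_ge0.
rewrite !(dotDl, dotDr, dotZl, dotZr) -!enorm_sqr (dotC y x) => H.
have : 0 <= 2 * (enorm x * enorm y) * (enorm x * enorm y - dot x y).
  by move: H; congr (0 <= _); ring.
by rewrite pmulr_rge0 ?subr_ge0 // !mulr_gt0.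
Qed.

Lemma enormZ a x : enorm (a *: x) = `|a| * enorm x.
Proof.
by rewrite /enorm dotZl dotZr mulrA -expr2 sqrtrM ?sqr_ge0 // sqrtr_sqr.
Qed.

Lemma enormN x : enorm (- x) = enorm x.
Proof. by rewrite -scaleN1r enormZ normrN1 mul1r. Qed.

Lemma enormBC x y : enorm (x - y) = enorm (y - x).
Proof. by rewrite -enormN opprB. Qed.

Lemma enorm0 : enorm (0 : 'rV[R]_d) = 0.
Proof. by rewrite /enorm dot0l sqrtr0. Qed.

Lemma abs_dot_le x y : `|dot x y| <= enorm x * enorm y.
Proof.
rewrite ler_norml dot_le_enorm andbT lerNl.
by rewrite -mulN1r -dotZl scaleN1r -(enormN x) dot_le_enorm.
Qed.

Lemma enormD x y : enorm (x + y) <= enorm x + enorm y.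
Proof.
rewrite -(@ler_pXn2r _ 2) ?nnegrE ?addr_ge0 ?enorm_ge0 //.
rewrite enorm_sqr sqrrD !enorm_sqr dotDl !dotDr (dotC y x).
have := dot_le_enorm x y; lra.
Qed.

Lemma enorm_le_sum x : enorm x <= \sum_(i < d) `|x ord0 i|.
Proof.
rewrite -(@ler_pXn2r _ 2) ?nnegrE ?enorm_ge0 ?sumr_ge0 //.
rewrite enorm_sqr expr2 mulr_suml; apply: ler_sum => i _.
rewrite -expr2 -normr_id -real_normK ?num_real // normr_id expr2.
by apply: ler_wpM2l => //; rewrite (bigD1 i) //= lerDl sumr_ge0.
Qed.

Lemma enorm_delta (i : 'I_d) : enorm (delta_mx ord0 i : 'rV[R]_d) = 1.
Proof.
rewrite /enorm /dot (bigD1 i) //= big1 ?addr0; last first.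
  by move=> j ji; rewrite !mxE (negbTE ji) mul0r.
by rewrite !mxE !eqxx mulr1 sqrtr1.
Qed.

Lemma abs_coord_le_norm x i : `|x ord0 i| <= `|x|.
Proof.
rewrite [leRHS]/Num.norm /= mx_normrE.
by apply/bigmax_geP; right; exists (ord0, i).
Qed.

Lemma enorm_le_norm x : enorm x <= d%:R * `|x|.
Proof.
apply: le_trans (enorm_le_sum x) _.
rewrite -[in d%:R](card_ord d) -sum1_card natr_sum mulr_suml.
by apply: ler_sum => i _; rewrite mul1r abs_coord_le_norm.
Qed.

Definition elip (K : R) (f : 'rV[R]_d -> R) :=
  forall x y, `|f x - f y| <= K * enorm (x - y).

Definition rconvex (f : 'rV[R]_d -> R) :=
  forall x y (t : R), 0 < t < 1 ->
  f (t *: x + (1 - t) *: y) <= t * f x + (1 - t) * f y.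

Lemma elip_le K f x y : elip K f -> f x <= f y + K * enorm (x - y).
Proof.
move=> fK; rewrite -lerBlDl; exact: le_trans (ler_norm _) (fK x y).
Qed.

Lemma elip_continuous K f : elip K f -> continuous f.
Proof.
move=> fK x; apply/(@cvgrPdist_le _ _ _ (nbhs x) (nbhs_filter x)) => e e0.
have K0 : 0 < `|K| * d%:R + 1 by rewrite ltr_wpDl ?mulr_ge0.
apply/nbhs_ballP; exists (e / (`|K| * d%:R + 1)) => [/=|y].
  by rewrite divr_gt0.
rewrite -ball_normE /= => /ltW xy; apply: le_trans (fK x y) _.
apply: (@le_trans _ _ ((`|K| * d%:R + 1) * `|x - y|)).
  apply: (@le_trans _ _ (`|K| * (d%:R * `|x - y|))).
    apply: le_trans (ler_wpM2l _ (enorm_le_norm _)) => //.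
    by rewrite ler_wpM2r ?enorm_ge0 ?ler_norm.
  by rewrite mulrA ler_wpM2r // lerDl.
by rewrite mulrC -ler_pdivlMr.
Qed.

Lemma enorm_lip : elip 1 (@enorm R d).
Proof.
move=> x y; rewrite mul1r ler_norml; apply/andP; split.
  by rewrite lerNl opprB lerBlDr enormBC -{1}(subrK x y) enormD.
by rewrite lerBlDr -{1}(subrK y x) enormD.
Qed.

Lemma open_eball (r : R) : open (eball r : set 'rV[R]_d).
Proof.
have -> : eball r = @enorm R d @^-1` [set t | t < r] by [].
apply: open_comp; last exact: open_lt.
by move=> x _; exact: (elip_continuous _ _ enorm_lip).
Qed.

End euclidean_facts.

(** * Borel sets of row vectors *)

Section borel.
Context {R : realType} {d : nat}.

Lemma measurable_open (U : set 'rV[R]_d) :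
  open U -> measurable (U : set (Rd R d)).
Proof. by move=> oU; apply: sub_sigma_algebra. Qed.

Lemma measurable_eball (r : R) : measurable (eball r : set (Rd R d)).
Proof. by apply: measurable_open; exact: open_eball. Qed.

Lemma measurable_lsc (f : 'rV[R]_d -> \bar R) :
  lower_semicontinuous f -> measurable_fun setT (f : Rd R d -> \bar R).
Proof.
move=> scif; apply: (measurability _ (ErealGenOInfty.measurableE R)).
move=> /= _ [_ [a ->]] <-; apply: measurableI => //; apply: measurable_open.
by rewrite preimage_itvoy; move/lower_semicontinuousP : scif; exact.
Qed.

Lemma measurable_continuous (f : 'rV[R]_d -> R) :
  continuous f -> measurable_fun setT (f : Rd R d -> R).
Proof.
move=> cf; apply: (measurability _ (RGenOpens.measurableE R)).
move=> _ [_ [a [b ->] <-]]; rewrite setTI; apply: measurable_open.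
by apply: open_comp => [x _|]; [exact: cf|exact: interval_open].
Qed.

Lemma measurable_elip K (f : 'rV[R]_d -> R) :
  elip K f -> measurable_fun setT (f : Rd R d -> R).
Proof. by move=> fK; apply: measurable_continuous; exact: elip_continuous fK. Qed.

Lemma measurable_coord (i : 'I_d) :
  measurable_fun setT (fun x : Rd R d => (x : 'rV[R]_d) ord0 i).
Proof.
apply: (@measurable_elip 1) => x y; rewrite mul1r.
by apply: le_trans (abs_coord_le_enorm _ i); rewrite !mxE.
Qed.

(** Sup-norm balls, with rational center and radius [1 / (p.2 + 1)]: a
    countable basis. It reduces Borel measurability to coordinates, and makes
    the complement of a support negligible. *)
Definition rat_ball (p : 'rV[rat]_d * nat) : set 'rV[R]_d :=
  [set x | forall i, `|x ord0 i - ratr (p.1 ord0 i)| < p.2.+1%:R^-1].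

Lemma measurable_rat_ball p : measurable (rat_ball p : set (Rd R d)).
Proof.
have -> : rat_ball p = \bigcap_(i in [set: 'I_d])
    [set x | `|x ord0 i - ratr (p.1 ord0 i)| < p.2.+1%:R^-1].
  by apply/seteqP; split => [x H i _|x H i]; exact: H.
apply: fin_bigcap_measurable => // i _; apply: measurable_open.
set g := fun x : 'rV[R]_d => `|x ord0 i - ratr (p.1 ord0 i)|.
apply: (@open_comp _ _ g [set t | t < p.2.+1%:R^-1]); last exact: open_lt.
move=> x _; apply: (@elip_continuous _ _ 1) => {}x y; rewrite mul1r /g.
apply: le_trans (ler_dist_dist _ _) _; rewrite opprD addrACA opprK addNr addr0.
by apply: le_trans (abs_coord_le_enorm _ i); rewrite !mxE.
Qed.

Lemma rat_ball_sub (U : set 'rV[R]_d) x : open U -> U x ->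
  exists p, rat_ball p x /\ rat_ball p `<=` U.
Proof.
move=> oU Ux; have /nbhs_ballP[e /= e0 eU] : nbhs x U by exact: open_nbhs_nbhs.
have [n ne] : exists n, n.+1%:R^-1 < e / 2.
  have := near_infty_natSinv_lt (PosNum (divr_gt0 e0 (ltr0Sn R 1))).
  by move=> [n _ /(_ n (leqnn n))] /= ?; exists n.
have [q xq] : exists q : 'I_d -> rat,
    forall i, `|x ord0 i - ratr (q i)| < n.+1%:R^-1.
  suff H : forall i : 'I_d, exists q : rat,
      `|x ord0 i - ratr q| < n.+1%:R^-1 by have [q] := boolp.choice H; exists q.
  move=> i.
  have lt_xn : x ord0 i - n.+1%:R^-1 < x ord0 i + n.+1%:R^-1.
    by rewrite ltrD2l gtrN // invr_gt0.
  have [q /itvP qx] := rat_in_itvoo lt_xn.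
  by exists q; rewrite distrC ltr_distl !qx.
exists (\row_i q i, n); split => [i|y xy] /=; first by rewrite mxE; exact: xq.
apply: eU; rewrite -ball_normE /=.
have e20 : 0 < e / 2 by rewrite divr_gt0.
rewrite [ltLHS]/Num.norm /= mx_normrE; apply/bigmax_ltP; split => // -[i j] _ /=.
rewrite !mxE (ord1 i) [ltRHS]splitr.
apply: le_lt_trans (ler_distD (ratr (q j)) _ _) _.
apply: ltrD; apply: lt_trans ne; first exact: xq.
by have := xy j; rewrite mxE distrC.
Qed.

Lemma open_rat_balls (U : set 'rV[R]_d) : open U ->
  U = \bigcup_(p in [set p | rat_ball p `<=` U]) rat_ball p.
Proof.
move=> oU; apply/seteqP; split => [x Ux|x [p pU]]; last exact: pU.
by have [p [px pU]] := rat_ball_sub _ _ oU Ux; exists p.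
Qed.

(** Preimages of rational balls only involve coordinates, and open sets are
    countable unions of them. *)
Lemma measurable_coordP {disp} {T : measurableType disp} (f : T -> Rd R d) :
  (forall i, measurable_fun setT (fun t => (f t : 'rV[R]_d) ord0 i)) ->
  measurable_fun setT f.
Proof.
move=> mf; apply: (@measurability _ _ _ _ setT f (@open 'rV[R]_d)) => //.
move=> _ [U oU <-]; rewrite setTI (open_rat_balls _ oU) preimage_bigcup.
rewrite bigcup_mkcond; apply: countable_bigcupT_measurable => [|p].
  exact: countableP.
case: ifP => // _; rewrite (_ : _ @^-1` _ = \bigcap_(i in [set: 'I_d])
    [set t | `|(f t : 'rV[R]_d) ord0 i - ratr (p.1 ord0 i)| < p.2.+1%:R^-1]).
  apply: fin_bigcap_measurable => // i _.
  rewrite -[X in measurable X]setTI.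
  pose g t := `|(f t : 'rV[R]_d) ord0 i - ratr (p.1 ord0 i)|.
  have mg : measurable_fun setT g.
    by apply: measurableT_comp => //; exact: measurable_funB.
  apply: (mg measurableT [set t | t < p.2.+1%:R^-1]).
  by apply: open_measurable; exact: open_lt.
by apply/seteqP; split => [t H i _|t H i]; exact: H.
Qed.

End borel.

(** * Lebesgue measure on a box *)

Section integral_facts.
Context {disp} {T : measurableType disp} {R : realType}.
Local Open Scope ereal_scope.
Import HBNNSimple.

(** The integral of a function that is not known to be measurable is still
    monotone, since it is the supremum over simple functions below. *)
Lemma integral_mono (mu : {measure set T -> \bar R}) (D : set T)
    (f g : T -> \bar R) :
  (forall x, D x -> f x <= g x) ->
  \int[mu]_(x in D) f x <= \int[mu]_(x in D) g x.
Proof.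
move=> fg.
have sub_patch (u v : T -> \bar R) x : (forall x, D x -> u x <= v x) ->
    (u \_ D) x <= (v \_ D) x.
  by move=> uv; rewrite !patchE; case: ifPn => // /set_mem /uv.
have mono (u v : T -> \bar R) : (forall x, D x -> 0 <= u x) ->
    (forall x, D x -> u x <= v x) ->
    \int[mu]_(x in D) u x <= \int[mu]_(x in D) v x.
  move=> u0 uv; have v0 x : D x -> 0 <= v x.
    by move=> Dx; apply: le_trans (uv x Dx); exact: u0.
  rewrite !ge0_integralE //; apply: ereal_sup_le => _ [h /= hu <-].
  exists h => // x.
  by apply: le_trans (hu x) _; exact: sub_patch.
rewrite integralE [leRHS]integralE; apply: leeB; apply: mono => x Dx.
- by rewrite funeposE le_max lexx orbT.
- by rewrite !funeposE ge_max !le_max fg //= lexx orbT.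
- by rewrite funenegE le_max lexx orbT.
- by rewrite !funenegE ge_max !le_max leeN2 fg //= lexx orbT.
Qed.

Lemma integral_mrestr (mu : {measure set T -> \bar R}) (D : set T)
    (mD : measurable D) (f : T -> \bar R) :
  measurable_fun setT f -> (forall x, 0 <= f x) ->
  \int[mrestr mu mD]_x f x = \int[mu]_(x in D) f x.
Proof.
move=> mf f0; have mDC := measurableC mD.
rewrite -(setUv D) ge0_integral_setU /= ?setUv //; last first.
  by apply/disj_setPCl.
rewrite [X in _ + X](_ : _ = 0) ?adde0; last first.
  rewrite null_set_integral //; first exact: measurable_funTS.
  by rewrite /= /mrestr setICl measure0.
by apply: eq_measure_integral => A mA AD; rewrite /= /mrestr setIidl.
Qed.

Definition finite_mrestr (mu : {measure set T -> \bar R}) (D : set T)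
    (mD : measurable D) (Dfin : mu D < +oo) : {finite_measure set T -> \bar R} :=
  mfrestr mD Dfin.

End integral_facts.

Section box_measure.
Context {R : realType}.
Local Open Scope ereal_scope.

Definition seg (r : R) : set R := `[(- r)%R, r].

Lemma measurable_seg r : measurable (seg r). Proof. exact: measurable_itv. Qed.

Lemma lebesgue_seg r : (0 < r)%R -> lebesgue_measure (seg r) = (2 * r)%:E.
Proof.
move=> r0; rewrite lebesgue_measure_itv /= lte_fin gtrN // -EFinD.
by congr (_%:E); ring.
Qed.

Lemma lebesgue_seg_lty r : lebesgue_measure (seg r) < +oo.
Proof.
rewrite lebesgue_measure_itv /=; case: ifP => _; last exact: ltry.
by rewrite -EFinB ltry.
Qed.

(** The carrier is the type on which [lebesgue_measure] is declared, so that
    the integrals below match those of [lebesgue_rV]. *)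
Definition seg_measure r : {finite_measure set (measurableTypeR R) -> \bar R} :=
  @finite_mrestr _ (measurableTypeR R) R (@lebesgue_measure R) _
    (measurable_seg r) (lebesgue_seg_lty r).

Definition box (r : R) (d : nat) : set 'rV[R]_d :=
  [set x | forall i, (`|x ord0 i| <= r)%R].

Definition upd {d} (x : 'rV[R]_d) (i : 'I_d) (t : R) : 'rV[R]_d :=
  (\row_j if j == i then t else x ord0 j)%R.

Definition cons_row {k} (p : measurableTypeR R * Rd R k) : Rd R k.+1 :=
  row_mx (const_mx p.1 : 'rV[R]_1) (p.2 : 'rV[R]_k).

Lemma cons_row0 k (p : measurableTypeR R * Rd R k) :
  (cons_row p : 'rV[R]_k.+1) ord0 ord0 = p.1.
Proof.
by rewrite mxE; case: splitP => // j _; rewrite mxE.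
Qed.

Lemma cons_rowS k (p : measurableTypeR R * Rd R k) j :
  (cons_row p : 'rV[R]_k.+1) ord0 (lift ord0 j) = (p.2 : 'rV[R]_k) ord0 j.
Proof.
rewrite mxE; case: splitP => [[[|//] ?] //|j' /= jj'].
by congr (_ _ _); apply/val_inj; case: jj'.
Qed.

Lemma measurable_cons_row k : measurable_fun setT (@cons_row k).
Proof.
apply: measurable_coordP => i; case: (unliftP ord0 i) => [j|] ->.
  rewrite (_ : (fun _ => _) =
    (fun y : Rd R k => (y : 'rV[R]_k) ord0 j) \o snd); last first.
    by apply/funext => p; rewrite cons_rowS.
  exact: (measurableT_comp (measurable_coord j) measurable_snd).
rewrite (_ : (fun _ => _) = fst) //.
by apply/funext => p; rewrite cons_row0.
Qed.

Section cons_measure.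
Variables (r : R) (k : nat) (m : {finite_measure set (Rd R k) -> \bar R}).

Definition cons_measure : set (Rd R k.+1) -> \bar R :=
  pushforward (seg_measure r \x m) (@cons_row k).

HB.instance Definition _ := Measure.copy cons_measure
  (measure_function_pushforward__canonical__measure_function_Measure
    (seg_measure r \x m) (measurable_cons_row k)).

Let cons_measure_fin : fin_num_fun cons_measure.
Proof.
apply: lty_fin_num_fun; change ((seg_measure r \x m) setT < +oo).
rewrite -setXTT product_measure1E // -ge0_fin_numE ?mule_ge0 //.
by rewrite fin_numM ?fin_num_measure.
Qed.

HB.instance Definition _ :=
  Measure_isFinite.Build _ _ _ cons_measure cons_measure_fin.

End cons_measure.

(** On subsets of a box the iterated integral [lebesgue_rV] is a genuine finite
    measure, built by taking the product with one segment at a time. The last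
    item is the consequence of Fubini that matters: a bound on the integrals
    along all lines parallel to the i-th axis bounds the full integral. It is
    proved along with the construction, since the i-th coordinate is either
    the one just added or one of the previous factor. *)
Lemma box_measure_exists (r : R) (d : nat) : (0 < r)%R ->
  exists m : {finite_measure set (Rd R d) -> \bar R},
  [/\ forall A : set (Rd R d), measurable A -> A `<=` box r d ->
        lebesgue_rV A = m A,
      m setT = ((2 * r) ^+ d)%:E &
      forall (i : 'I_d) (g : Rd R d -> \bar R) (c : R),
        measurable_fun setT g -> (forall x, 0 <= g x) ->
        (forall x, \int[seg_measure r]_t g (upd x i t) <= c%:E) ->
        \int[m]_x g x <= (c * (2 * r) ^+ d.-1)%:E].
Proof.
move=> r0; have r20 : (0 <= 2 * r)%R by rewrite mulr_ge0 // ltW.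
have segT : seg_measure r setT = (2 * r)%:E.
  by rewrite /seg_measure /= /mfrestr /mrestr setTI lebesgue_seg.
elim: d => [|k [m [mE mT mI]]].
  exists (@dirac _ (Rd R 0) (0%R : 'rV[R]_0) R : {finite_measure set (Rd R 0) -> \bar R}).
  split => [A mA _||[]//]; first by rewrite /= /dirac.
  by rewrite /= diracT expr0.
exists (cons_measure r k m); split.
- move=> A mA Abox /=.
  rewrite /cons_measure /pushforward /product_measure1.
  have mA' : measurable (@cons_row k @^-1` A).
    by rewrite -[X in measurable X]setTI; exact: measurable_cons_row.
  rewrite integral_mrestr //; last 1 first.
    exact: measurable_fun_xsection.
  rewrite [RHS]integral_mkcond; apply: eq_integral => t _.
  rewrite patchE; case: ifPn => [tr|/negP tr].
    rewrite /comp -mE.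
    + by congr lebesgue_rV; apply/seteqP; split => y; rewrite /xsection /= inE.
    + exact: measurable_xsection.
    + move=> y; rewrite /xsection /= inE => /Abox + i => /(_ (lift ord0 i)).
      by rewrite cons_rowS.
  (* A first coordinate outside the segment gives an empty section. *)
  rewrite (_ : [set y | _] = set0) ?mE ?measure0 //.
  apply/seteqP; split => // y /Abox /(_ ord0).
  rewrite (cons_row0 _ (t, y)) /= => tr'; apply: tr; rewrite inE /seg /= in_itv /=.
  by rewrite -ler_norml.
- change ((seg_measure r \x m) setT = ((2 * r) ^+ k.+1)%:E); rewrite -setXTT.
  rewrite product_measure1E //.
  by rewrite [X in _ * X]mT [X in X * _]segT -EFinM exprS.
- move=> i g c mg g0 gc.
  have mg' : measurable_fun setT (g \o @cons_row k).
    by apply: measurableT_comp mg _; exact: measurable_cons_row.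
  have -> : \int[cons_measure r k m]_x g x =
      \int[seg_measure r \x m]_z (g \o @cons_row k) z.
    apply: etrans (ge0_integral_pushforward (measurable_cons_row k) _ _ _ _) _ => //.
  case: (unliftP ord0 i) gc => [j|] -> gc.
    rewrite fubini_tonelli1 //; last by move=> ?; exact: g0.
    apply: (@le_trans _ _ (\int[seg_measure r]_x (c * (2 * r) ^+ k.-1)%:E)).
      apply: integral_mono => x _; rewrite /fubini_F.
      apply: (mI j (fun y => g (cons_row (x, y)))) => //.
        by apply: (measurableT_comp mg'); exact: measurable_pair1.
      move=> y; apply: le_trans (gc (cons_row (x, y))).
      apply: integral_mono => t _; rewrite le_eqVlt; apply/orP; left; apply/eqP.
      congr g; apply/rowP => l; case: (unliftP ord0 l) => [l'|] ->.
        by rewrite cons_rowS [LHS]mxE [RHS]mxE (inj_eq lift_inj) cons_rowS.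
      by rewrite cons_row0 [RHS]mxE (negbTE (neq_lift _ _)) cons_row0.
    rewrite integral_cst // [X in _ * X]segT -EFinM lee_fin /= -mulrA.
    by rewrite -exprSr prednK // (leq_ltn_trans _ (ltn_ord j)).
  rewrite fubini_tonelli2 //; last by move=> ?; exact: g0.
  apply: (@le_trans _ _ (\int[m]_y c%:E)).
    apply: integral_mono => y _; rewrite /fubini_G.
    apply: le_trans (gc (cons_row (0%R, y))).
    apply: integral_mono => t _; rewrite le_eqVlt; apply/orP; left; apply/eqP.
    congr g; apply/rowP => l; case: (unliftP ord0 l) => [l'|] ->.
      by rewrite cons_rowS [RHS]mxE eq_sym (negbTE (neq_lift _ _)) cons_rowS.
    by rewrite cons_row0 [RHS]mxE eqxx.
  by rewrite integral_cst // [X in _ * X]mT -EFinM.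
Qed.

End box_measure.

(** * Second differences *)

Section one_dimension.
Context {R : realType}.

(** The second difference of [F] is the derivative of [t |-> S t - S (t - h)],
    where [S] is the first difference of a primitive of [F]. So its integral
    only depends on the ends of the segment, where the mean value theorem
    applies to [S]: the derivative of [S] is a first difference of [F], at most
    [K * h]. *)
Lemma integral_second_difference (F : R -> R) (K h r : R) :
  0 < h -> 0 < r -> (forall s t, `|F s - F t| <= K * `|s - t|) ->
  (\int[lebesgue_measure]_(t in seg r) (F (t + h) + F (t - h) - 2 * F t)%:E
    <= (2 * K * h ^+ 2)%:E)%E.
Proof.
move=> h0 r0 FK.
have K0 : 0 <= K.
  by have := FK 1 0; rewrite subr0 normr1 mulr1; apply: le_trans.
have cF : continuous F.
  move=> t; apply/cvgrPdist_le => e e0; apply/nbhs_ballP.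
  have K1 : 0 < K + 1 by rewrite ltr_wpDl.
  exists (e / (K + 1)) => [/=|s]; first by rewrite divr_gt0.
  move=> /= /ltW ts; apply: le_trans (FK t s) _.
  apply: (@le_trans _ _ ((K + 1) * `|t - s|)); first by rewrite ler_wpM2r ?lerDl.
  by rewrite mulrC -ler_pdivlMr.
(* The margins leave room for shifts by h and for two-sided derivatives. *)
pose a := - r - h - 1; pose b := r + h + 1.
pose P x := (\int[lebesgue_measure]_(t in `[a, x]) F t)%R.
have dP x : a < x < b -> is_derive x 1 P (F x).
  move=> /andP[ax xb]; have [] := @continuous_FTC1_closed R F a x b xb _ ax (cF x).
    apply: continuous_compact_integrable; first exact: segment_compact.
    exact: continuous_subspaceT.
  by move=> dPx PF; apply: DeriveDef => //; rewrite -derive1E.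
have dPs c x : a < x + c < b -> is_derive x 1 (fun t => P (t + c)) (F (x + c)).
  move=> /dP dPc.
  have dsh : is_derive x 1 (fun t : R => t + c) 1.
    by apply: is_derive_eq; rewrite addr0.
  by have := @is_derive1_comp _ _ (fun t => t + c) x _ _ dPc dsh; rewrite mulr1.
pose S t := P (t + h) - P t.
have dS x : a < x -> x + h < b -> is_derive x 1 S (F (x + h) - F x).
  move=> ax xb.
  have d1 := dPs h x; have d2 := dP x.
  have {}d1 := d1 ltac:(lra); have {}d2 := d2 ltac:(lra).
  exact: is_deriveB.
have dSs x : a < x - h -> x < b ->
    is_derive x 1 (fun t => S (t - h)) (F x - F (x - h)).
  move=> ax xb.
  have := dS (x - h) ax; rewrite subrK => /(_ xb) dSc.
  have dsh : is_derive x 1 (fun t : R => t - h) 1.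
    by apply: is_derive_eq; rewrite subr0.
  by have := @is_derive1_comp _ _ (fun t => t - h) x _ _ dSc dsh; rewrite mulr1.
pose D t := S t - S (t - h).
have dD x : - r - 1 < x < r + 1 ->
    is_derive x 1 D (F (x + h) + F (x - h) - 2 * F x).
  move=> /andP[rx xr].
  have d1 := dS x ltac:(rewrite /a; lra) ltac:(rewrite /b; lra).
  have d2 := dSs x ltac:(rewrite /a; lra) ltac:(rewrite /b; lra).
  have := is_deriveB d1 d2; congr is_derive; ring.
have bD x : - r <= x <= r -> `|D x| <= K * h ^+ 2.
  move=> /andP[rx xr].
  have [|||c _ Dc] := @MVT_segment R S (fun t => F (t + h) - F t) (x - h) x.
  - lra.
  - move=> t; rewrite in_itv /= => /andP[t1 t2].
    by apply: dS; rewrite /a /b; lra.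
  - apply: derivable_within_continuous => t; rewrite in_itv /= => /andP[t1 t2].
    by have [] := dS t ltac:(rewrite /a; lra) ltac:(rewrite /b; lra).
  rewrite /D Dc opprB addrCA subrr addr0 normrM (gtr0_norm h0) expr2 mulrA.
  rewrite (ler_wpM2r (ltW h0)) //; apply: le_trans (FK _ _) _.
  by rewrite addrAC subrr add0r (gtr0_norm h0).
rewrite /seg (@continuous_FTC2 R _ D) //.
- rewrite -EFinD lee_fin.
  have := bD r ltac:(lra); have := bD (- r) ltac:(lra).
  rewrite !ler_norml => /andP[u1 _] /andP[_ u2].
  by rewrite -mulrA mulr_natl mulr2n lerD // lerNl.
- lra.
- apply: continuous_subspaceT => t.
  apply: cvgB; first apply: cvgD.
  + by apply: continuous_comp; [apply: cvgD; [exact: cvg_id|exact: cvg_cst]|exact: cF].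
  + by apply: continuous_comp; [apply: cvgB; [exact: cvg_id|exact: cvg_cst]|exact: cF].
  + by apply: cvgM; [exact: cvg_cst|exact: cF].
- have Dcont x : - r - 1 < x < r + 1 -> {for x, continuous D}.
    by move=> /dD[dDx _]; apply: differentiable_continuous; apply/derivable1_diffP.
  split.
  + by move=> x; rewrite in_itv /= => xr; have [] := dD x ltac:(lra).
  + by apply: cvg_at_right_filter; apply: Dcont; lra.
  + by apply: cvg_at_left_filter; apply: Dcont; lra.
- move=> x; rewrite in_itv /= => xr; have := dD x ltac:(lra).
  by move=> dDx; rewrite derive1E derive_val.
Qed.

End one_dimension.

Section second_difference.
Context {R : realType} {d : nat}.

Definition sdiff (f : 'rV[R]_d -> R) (i : 'I_d) (h : R) (x : 'rV[R]_d) : R :=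
  f (x + h *: delta_mx ord0 i) + f (x - h *: delta_mx ord0 i) - 2 * f x.

Lemma upd_add (x : 'rV[R]_d) i s t :
  upd x i s + t *: delta_mx ord0 i = upd x i (s + t).
Proof.
apply/rowP => j; rewrite !mxE eqxx /=.
by case: eqP => _; rewrite ?mulr1 ?mulr0 ?addr0.
Qed.

Lemma enorm_updB (x : 'rV[R]_d) i s t : enorm (upd x i s - upd x i t) = `|s - t|.
Proof.
have -> : upd x i s - upd x i t = (s - t) *: delta_mx ord0 i.
  apply/rowP => j; rewrite !mxE eqxx /=.
  by case: eqP => _; rewrite ?mulr1 // mulr0 subrr.
by rewrite enormZ enorm_delta mulr1.
Qed.

Lemma sdiff_ge0 f i h x : rconvex f -> 0 <= sdiff f i h x.
Proof.
move=> fc; rewrite /sdiff; set v := h *: _.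
have := fc (x + v) (x - v) 2^-1 ltac:(lra).
have -> : 2^-1 *: (x + v) + (1 - 2^-1) *: (x - v) = x.
  by apply/rowP => j; rewrite !mxE; field.
lra.
Qed.

Lemma elip_shift (K : R) (f : 'rV[R]_d -> R) v : elip K f -> elip K (fun x => f (x + v)).
Proof.
move=> fK x y; apply: le_trans (fK _ _) _.
by rewrite opprD addrACA subrr addr0.
Qed.

Lemma measurable_sdiff K f i h : elip K f ->
  measurable_fun setT (sdiff f i h : Rd R d -> R).
Proof.
move=> fK; apply: measurable_funB.
  apply: measurable_funD; first exact: measurable_elip (elip_shift _ _ _ fK).
  exact: measurable_elip (elip_shift _ _ _ fK).
by apply: measurable_funM => //; exact: measurable_elip fK.
Qed.

(** A quantitative form of the fact that gradients of convex functions have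
    bounded variation. Convexity makes the integrand nonnegative, which allows
    [mu] to be replaced by [M] times Lebesgue measure on a box; there the
    one-dimensional estimate applies on each line. *)
Lemma integral_sdiff_le (mu : {measure set (Rd R d) -> \bar R}) (M r K h : R) f i :
  0 < M -> 0 < r -> 0 < h -> elip K f -> rconvex f ->
  mu (~` eball r) = 0%E ->
  (forall A : set (Rd R d), measurable A -> (mu A <= M%:E * lebesgue_rV A)%E) ->
  (\int[mu]_x (sdiff f i h x)%:E <=
    (M * (2 * K * (2 * r) ^+ d.-1) * h ^+ 2)%:E)%E.
Proof.
move=> M0 r0 h0 fK fc mu0 muM.
have [m [mE _ mI]] := box_measure_exists r d r0.
have M0' : 0 <= M by exact: ltW.
pose mM := mscale (NngNum M0') m.
have mumM A : measurable A -> (mu A <= mM A)%E.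
  move=> mA; have mB := measurable_eball r : measurable (eball r : set (Rd R d)).
  have mAB := measurableI _ _ mA mB.
  apply: (@le_trans _ _ (mu (A `&` eball r))).
    rewrite (measureDI _ mA mB) [X in (X + _)%E](_ : _ = 0%E) ?add0e //.
    by apply: subset_measure0 mu0; [exact: measurableD|exact: measurableC|move=> x []].
  apply: le_trans (muM _ mAB) _; rewrite mE //.
    rewrite /mM /mscale /= lee_pmul2l // ?lte_fin //.
    by apply: le_measure; rewrite ?inE //; move=> x [].
  by move=> x [_ xr] j; apply: ltW (le_lt_trans (abs_coord_le_enorm _ _) xr).
have msd : measurable_fun setT (fun x : Rd R d => (sdiff f i h x)%:E).
  by apply/measurable_EFinP; exact: measurable_sdiff fK.
have sd0 x : (0 <= (sdiff f i h x)%:E)%E by rewrite lee_fin sdiff_ge0.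
apply: (@le_trans _ _ (\int[mM]_x (sdiff f i h x)%:E)%E).
  exact: ge0_le_measure_integral.
rewrite ge0_integral_mscale //= -!mulrA EFinM lee_pmul2l ?lte_fin //.
have -> : 2 * (K * ((2 * r) ^+ d.-1 * h ^+ 2)) = 2 * K * h ^+ 2 * (2 * r) ^+ d.-1.
  by ring.
apply: mI => // x.
rewrite integral_mrestr //; last first.
  apply/measurable_EFinP.
  have mupd : measurable_fun setT
      (fun t : measurableTypeR R => upd x i t : Rd R d).
    apply: measurable_coordP => j.
    rewrite (_ : (fun _ => _) = fun t => if j == i then t else x ord0 j).
      by case: eqP => _; [exact: measurable_id|exact: measurable_cst].
    by apply/funext => t; rewrite mxE.
  exact: (measurableT_comp (measurable_sdiff _ _ _ _ fK) mupd).
under eq_integral do rewrite /sdiff upd_add -scaleNr upd_add.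
apply: (integral_second_difference (fun t => f (upd x i t))) => // s t.
by apply: le_trans (fK _ _) _; rewrite enorm_updB.
Qed.
End second_difference.

(** * Concentrated measures and the Wasserstein distance *)

Section concentrated.
Context {disp} {T : measurableType disp} {R : realType}.
Variables (P : probability T R) (B : set T).
Hypotheses (mB : measurable B) (PB : P (~` B) = 0%E).
Local Open Scope ereal_scope.

Lemma integral_concentrated (f : T -> \bar R) : measurable_fun setT f ->
  \int[P]_x f x = \int[P]_(x in B) f x.
Proof.
move=> mf.
have E g : measurable_fun setT g -> (forall x, 0 <= g x) ->
    \int[P]_x g x = \int[P]_(x in B) g x.
  move=> mg g0; rewrite (ge0_negligible_integral (measurableC mB)) //.
  by rewrite setTD setCK.
rewrite integralE [RHS]integralE !E //.
- exact: measurable_funeneg.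
- exact: measurable_funepos.
Qed.

Lemma le_integral_concentrated (f g : T -> \bar R) :
  measurable_fun setT f -> measurable_fun setT g ->
  (forall x, B x -> f x <= g x) -> \int[P]_x f x <= \int[P]_x g x.
Proof.
by move=> mf mg fg; rewrite !integral_concentrated //; exact: integral_mono.
Qed.

Lemma integrable_concentrated (f : T -> R) (K : R) : measurable_fun setT f ->
  (forall x, B x -> (`|f x| <= K)%R) -> P.-integrable setT (EFin \o f).
Proof.
move=> mf fK; have mEf : measurable_fun setT (EFin \o f) by exact/measurable_EFinP.
apply/integrableP; split => //.
have mabs : measurable_fun setT (fun x => `|(EFin \o f) x|).
  exact: measurableT_comp.
rewrite integral_concentrated //.
apply: (@le_lt_trans _ _ (\int[P]_(x in B) K%:E)).
  by apply: integral_mono => x Bx; rewrite /= lee_fin fK.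
by rewrite integral_cst // ltey_eq fin_numM // fin_num_measure.
Qed.

End concentrated.

Section supports.
Context {R : realType} {d : nat}.
Local Open Scope ereal_scope.

(** The complement of the support is covered by the null rational balls, which
    are countably many. *)
Lemma measure_compl_msupport (alpha : probability (Rd R d) R)
    (A : set (Rd R d)) :
  measurable A -> A `&` msupport alpha = set0 -> alpha A = 0.
Proof.
move=> mA Asupp.
pose F (n : nat) : set (Rd R d) :=
  if unpickle n is Some p then
    if alpha (rat_ball p) == 0 then rat_ball p else set0
  else set0.
have F0 n : alpha.-negligible (F n).
  rewrite /F; case: unpickle => [p|]; last exact: negligible_set0.
  case: eqP => [p0|_]; last exact: negligible_set0.
  by exists (rat_ball p); split => //; exact: measurable_rat_ball.
apply/negligibleP => //; apply: negligibleS (negligible_bigcup F0).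
move=> x Ax; have : ~ msupport alpha x.
  by move=> xs; have : set0 x by rewrite -Asupp.
move=> /existsNP[U /not_implyP[oU /not_implyP[Ux /negP]]].
rewrite -leNgt => U0; have [p [px pU]] := rat_ball_sub _ _ oU Ux.
exists (pickle p) => //; rewrite /F pickleK.
have mp : measurable (rat_ball p : set (Rd R d)) by exact: measurable_rat_ball.
suff -> : alpha (rat_ball p) == 0 by [].
rewrite eq_le measure_ge0 andbT; apply: le_trans U0.
by apply: le_measure; rewrite ?inE //; exact: measurable_open.
Qed.

Lemma compl_eball_null (alpha : probability (Rd R d) R) (r : R) :
  msupport alpha `<=` eball r -> alpha (~` eball r) = 0.
Proof.
move=> sr; apply: measure_compl_msupport.
  by apply: measurableC; exact: measurable_eball.
by apply/seteqP; split => // x [xr /sr].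
Qed.

Lemma elip_bounded_eball (K r : R) (f : 'rV[R]_d -> R) (x : 'rV[R]_d) :
  (0 <= K)%R -> elip K f -> eball r x -> (`|f x| <= `|f 0| + K * r)%R.
Proof.
move=> K0 fK xr; rewrite -{1}(subrK (f 0%R) (f x)) addrC.
apply: le_trans (ler_normD _ _) _; rewrite lerD2l; apply: le_trans (fK _ _) _.
by rewrite subr0 ler_wpM2l // ltW.
Qed.

Lemma integrable_elip (alpha : probability (Rd R d) R) (K r : R)
    (f : 'rV[R]_d -> R) : (0 <= K)%R -> alpha (~` eball r) = 0 -> elip K f ->
  alpha.-integrable setT (EFin \o (f : Rd R d -> R)).
Proof.
move=> K0 ar fK.
apply: (integrable_concentrated alpha (eball r) (measurable_eball r) ar
  (f : Rd R d -> R) (`|f 0%R| + K * r)%R).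
- exact: measurable_elip fK.
- by move=> x xr; exact: elip_bounded_eball.
Qed.

Lemma wasserstein1_ge0 (alpha beta : probability (Rd R d) R) :
  0 <= wasserstein1 alpha beta.
Proof.
apply: le_ereal_inf_tmp => _ [pi _ <-]; apply: integral_ge0 => z _.
by rewrite lee_fin enorm_ge0.
Qed.

(** The easy half of Kantorovich-Rubinstein duality: for each coupling, write
    both integrals on the product and compare the integrands. *)
Lemma wasserstein1_elip (alpha beta : probability (Rd R d) R) (r K : R)
    (f : 'rV[R]_d -> R) : (0 < K)%R ->
  alpha (~` eball r) = 0 -> beta (~` eball r) = 0 -> elip K f ->
  (\int[alpha]_x (f x)%:E <=
   \int[beta]_x (f x)%:E + K%:E * wasserstein1 alpha beta).
Proof.
move=> K0 ar br fK; have K0' : (0 <= K)%R by exact: ltW.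
have fa := integrable_elip _ _ _ _ K0' ar fK.
have fb := integrable_elip _ _ _ _ K0' br fK.
have fa' : \int[alpha]_x (f x)%:E \is a fin_num by exact: integrable_fin_num.
have fb' : \int[beta]_x (f x)%:E \is a fin_num by exact: integrable_fin_num.
rewrite -leeBlDl // muleC -lee_pdivrMr //.
apply: le_ereal_inf_tmp => _ [pi [pia pib] <-].
rewrite lee_pdivrMr // muleC.
have mr : measurable (eball r : set (Rd R d)) by exact: measurable_eball.
have mf : measurable_fun setT (f : Rd R d -> R) by exact: measurable_elip fK.
have marg (g : Rd R d * Rd R d -> Rd R d) (gamma : probability (Rd R d) R) :
    measurable_fun setT g -> gamma (~` eball r) = 0 ->
    (forall A, measurable A -> pushforward pi g A = gamma A) ->
    pi.-integrable setT (EFin \o (f \o g)) /\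
    \int[gamma]_x (f x)%:E = \int[pi]_z (f (g z))%:E.
  move=> mg gr pig.
  have ig : pi.-integrable setT (EFin \o (f \o g)).
    have mgr : measurable (g @^-1` (eball r : set (Rd R d))).
      by rewrite -[X in measurable X]setTI; exact: mg.
    apply: (@integrable_concentrated _ _ _ pi _ mgr _ _ (`|f 0%R| + K * r)%R).
    - by rewrite -gr -pig //; exact: measurableC.
    - exact: measurableT_comp.
    - by move=> z zr; exact: elip_bounded_eball.
  split => //.
  transitivity (\int[pushforward pi g]_x (f x)%:E).
    by apply: eq_measure_integral => A mA _; exact: esym (pig A mA).
  by rewrite (integral_pushforward mg) //; exact/measurable_EFinP.
have [ia ->] := marg fst alpha measurable_fst ar pia.
have [ib ->] := marg snd beta measurable_snd br pib.
rewrite -integralB // -ge0_integralZl_EFin //; last 2 first.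
- by move=> z _; rewrite lee_fin enorm_ge0.
- apply/measurable_EFinP; rewrite /enorm.
  apply: measurableT_comp.
    by apply: continuous_measurable_fun; exact: sqrt_continuous.
  rewrite /dot; apply: measurable_sum => i.
  have mi : measurable_fun setT (fun z : Rd R d * Rd R d =>
      ((z.1 : 'rV[R]_d) - z.2) ord0 i)%R.
    rewrite (_ : (fun _ => _) = fun z : Rd R d * Rd R d =>
      ((z.1 : 'rV[R]_d) ord0 i - (z.2 : 'rV[R]_d) ord0 i)%R); last first.
      by apply/funext => z; rewrite !mxE.
    apply: measurable_funB.
      exact: (measurableT_comp (measurable_coord i) measurable_fst).
    exact: (measurableT_comp (measurable_coord i) measurable_snd).
  exact: measurable_funM.
apply: integral_mono => z _; rewrite -EFinD -EFinM lee_fin.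
exact: le_trans (ler_norm _) (fK _ _).
Qed.

End supports.

(** * Truncated conjugates and extensions *)

Section truncated_conjugate.
Context {R : realType} {d : nat}.
Variables (rho : R) (rho_ge0 : 0 <= rho).
Implicit Types (f : 'rV[R]_d -> R) (x y : 'rV[R]_d).

Definition cball : set 'rV[R]_d := [set x | enorm x <= rho].

(** The conjugate of [f] restricted to a closed ball. Unlike the conjugate of
    a Lipschitz [f] it is finite everywhere, and it is [rho]-Lipschitz. *)
Definition pconj f y : R := sup [set dot x y - f x | x in cball].

Lemma cball0 : cball 0.
Proof. by rewrite /cball /= enorm0. Qed.

Lemma pconj_ub K f x y : elip K f -> 0 <= K -> cball x ->
  dot x y - f x <= pconj f y.
Proof.
move=> fK K0 xr; apply: ub_le_sup; last by exists x.
exists (rho * enorm y + (`|f 0| + K * rho)) => _ [z zr <-].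
apply: lerD.
  by apply: le_trans (dot_le_enorm _ _) _; rewrite ler_wpM2r ?enorm_ge0.
rewrite lerNl; have := elip_le K f 0 z fK; rewrite sub0r enormN => fz.
have : K * enorm z <= K * rho by rewrite ler_wpM2l.
have := ler_norm (- f 0); rewrite normrN; lra.
Qed.

Lemma pconj_le f y c : (forall x, cball x -> dot x y - f x <= c) ->
  pconj f y <= c.
Proof.
move=> fc; apply: ge_sup; first by exists (dot 0 y - f 0), 0 => //; exact: cball0.
by move=> _ [x /fc + <-].
Qed.

Lemma pconj_elip K f : elip K f -> 0 <= K -> elip rho (pconj f).
Proof.
move=> fK K0.
suff H y z : pconj f y <= pconj f z + rho * enorm (y - z).
  move=> y z; rewrite ler_norml; apply/andP; split; last by rewrite lerBlDl.
  by rewrite lerNl opprB lerBlDl enormBC.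
apply: pconj_le => x xr.
have := pconj_ub K f x z fK K0 xr.
have : dot x (y - z) <= rho * enorm (y - z).
  by apply: le_trans (dot_le_enorm _ _) _; rewrite ler_wpM2r ?enorm_ge0.
rewrite dotDr -scaleN1r dotZr; lra.
Qed.

Local Open Scope ereal_scope.

Definition trunc f : 'rV[R]_d -> \bar R :=
  fun x => if (enorm x <= rho)%R then (f x)%:E else +oo.

Lemma trunc_Gamma0 K f : elip K f -> rconvex f -> Gamma0 (trunc f).
Proof.
move=> fK fc; split.
- split => [x|]; first by rewrite /trunc; case: ifP.
  by exists 0%R; rewrite /trunc enorm0 rho_ge0.
- apply/lower_semicontinuousP => a.
  have -> : [set x | a%:E < trunc f x] =
      (f @^-1` [set t | (a < t)%R]) `|` (@enorm R d @^-1` [set t | (rho < t)%R]).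
    apply/seteqP; split => x /=; rewrite /trunc;
      case: (leP (enorm x) rho) => xr.
    + by rewrite lte_fin; left.
    + by right.
    + by rewrite lte_fin => -[].
    + by rewrite ltry.
  apply: openU; apply: open_comp; try exact: open_gt.
  + by move=> x _; exact: (elip_continuous _ _ fK).
  + by move=> x _; exact: (elip_continuous _ _ enorm_lip).
- move=> x y t /[dup] t01 /andP[t0 t1].
  have t1' : (0 < 1 - t)%R by rewrite subr_gt0.
  rewrite /trunc; case: (leP (enorm x)) => xr; last first.
    rewrite gt0_muley ?lte_fin //; case: ifP => _; case: ifP => _;
    by rewrite ?gt0_muley ?lte_fin // addye ?leey // -?EFinM.
  case: (leP (enorm y)) => yr; last by rewrite gt0_muley ?lte_fin // -EFinM addey ?leey.
  rewrite ifT; first by rewrite -!EFinM -EFinD lee_fin; exact: fc.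
  apply: le_trans (enormD _ _) _; rewrite !enormZ !gtr0_norm //.
  have -> : rho = (t * rho + (1 - t) * rho)%R by ring.
  by apply: lerD; rewrite ler_wpM2l // ltW.
Qed.

Lemma conjugate_trunc K f y : elip K f -> (0 <= K)%R ->
  conjugate (trunc f) y <= (pconj f y)%:E.
Proof.
move=> fK K0; apply: ge_ereal_sup => _ [x _ <-]; rewrite /trunc.
case: ifP => [xr|_]; last by rewrite leNye.
by rewrite -EFinD lee_fin; exact: pconj_ub fK K0 xr.
Qed.

Lemma pconj_le_conjugate (phi : 'rV[R]_d -> \bar R) f y :
  (forall x, cball x -> phi x = (f x)%:E) -> (pconj f y)%:E <= conjugate phi y.
Proof.
move=> phif.
have sub x : cball x -> (dot x y - f x)%:E <= conjugate phi y.
  by move=> xr; apply: ereal_sup_ubound; exists x => //; rewrite phif.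
case E : (conjugate phi y) => [c| |]; [|by rewrite leey|].
  rewrite lee_fin; apply: pconj_le => x /sub.
  by rewrite E lee_fin.
by have := sub _ cball0; rewrite E.
Qed.

End truncated_conjugate.

Section conjugates.
Context {R : realType} {d : nat}.
Local Open Scope ereal_scope.
Implicit Types (g : 'rV[R]_d -> R) (x y : 'rV[R]_d).

Lemma conjugate_lsc (phi : 'rV[R]_d -> \bar R) :
  lower_semicontinuous (conjugate phi).
Proof.
apply/lower_semicontinuousP => a.
have -> : [set y | a%:E < conjugate phi y] =
    \bigcup_x [set y | a%:E < (dot x y)%:E - phi x].
  apply/seteqP; split => y /=.
    by move/ereal_sup_gt => [_ [x _ <-] ax]; exists x.
  by move=> [x _ ax]; apply: lt_le_trans ax _; apply: ereal_sup_ubound; exists x.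
apply: bigcup_open => x _; case: (phi x) => [c| |].
- rewrite (_ : [set _ | _] = dot x @^-1` [set t | (a + c < t)%R]); last first.
    by apply/seteqP; split => y /=; rewrite -EFinD lte_fin ltrBrDr.
  apply: open_comp; last exact: open_gt.
  move=> y _; apply: (@elip_continuous _ _ (enorm x)) => {}y z.
  by rewrite -mulN1r -dotZr scaleN1r -dotDr abs_dot_le.
- rewrite (_ : [set _ | _] = set0); first exact: open0.
  by apply/seteqP; split => y.
- rewrite (_ : [set _ | _] = setT); first exact: openT.
  by apply/seteqP; split => y //= _; rewrite ltry.
Qed.

Lemma conjugate_EFin_convex g : econvex (conjugate (EFin \o g)).
Proof.
move=> x y t /andP[t0 t1]; have t1' : (0 < 1 - t)%R by rewrite subr_gt0.
apply: ge_ereal_sup => _ [z _ <-] /=.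
have ub u : (dot z u - g z)%:E <= conjugate (EFin \o g) u.
  by apply: ereal_sup_ubound; exists z.
have -> : (dot z (t *: x + (1 - t) *: y))%:E - (g z)%:E =
    t%:E * (dot z x - g z)%:E + (1 - t)%:E * (dot z y - g z)%:E.
  by rewrite -EFinB -!EFinM -EFinD dotDr !dotZr; congr EFin; ring.
by apply: leeD; apply: lee_wpmul2l (ub _); rewrite lee_fin ltW.
Qed.

Lemma conjugate_EFin_Gamma0 g : (exists x, conjugate (EFin \o g) x < +oo) ->
  Gamma0 (conjugate (EFin \o g)).
Proof.
move=> [x xoo]; split; [|exact: conjugate_lsc|exact: conjugate_EFin_convex].
split => [y|]; last by exists x; rewrite lt_eqF.
have : (dot 0 y - g 0)%:E <= conjugate (EFin \o g) y.
  by apply: ereal_sup_ubound; exists 0%R.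
by case: (conjugate _ _).
Qed.

Lemma conjugate_conjugate_le g y : conjugate (conjugate (EFin \o g)) y <= (g y)%:E.
Proof.
apply: ge_ereal_sup => _ [x _ <-].
have : (dot y x - g y)%:E <= conjugate (EFin \o g) x.
  by apply: ereal_sup_ubound; exists y.
case: (conjugate _ _) => [c| |] //; rewrite ?leNye //.
by rewrite -EFinB !lee_fin dotC; lra.
Qed.

End conjugates.

Section extension.
Context {R : realType} {d : nat}.

(** McShane's formula [f x = inf_z (phi z + K * |x - z|)], with [z] in the ball,
    extends a Lipschitz function; being an infimal convolution of convex
    functions, the extension is convex. *)
Lemma elip_extension (rho K : R) (phi : 'rV[R]_d -> \bar R) :
  0 < rho -> 0 <= K -> econvex phi -> elipschitz K (eball rho) phi ->
  exists f : 'rV[R]_d -> R, [/\ elip K f, rconvex f &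
    forall x, eball rho x -> phi x = (f x)%:E].
Proof.
move=> rho0 K0 phic [phifin phiK].
pose g x := fine (phi x).
have gE x : eball rho x -> phi x = (g x)%:E by move=> xr; rewrite fineK ?phifin.
pose A x := [set g z + K * enorm (x - z) | z in eball rho].
have e0 : eball rho (0 : 'rV[R]_d) by rewrite /eball /= enorm0.
have A0 x : A x !=set0 by exists (g 0 + K * enorm (x - 0)), 0.
have Alb x : has_lbound (A x).
  exists (g 0 - K * enorm x) => _ [z zr <-].
  have := phiK _ _ zr e0; rewrite subr0 -/(g z) -/(g 0) ler_norml => /andP[gz _].
  have : K * enorm z <= K * (enorm x + enorm (x - z)).
    rewrite ler_wpM2l // enormBC addrC -{1}(subrK x z); exact: enormD.
  lra.
pose f x := inf (A x).
have f_le x z : eball rho z -> f x <= g z + K * enorm (x - z).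
  by move=> zr; apply: ge_inf => //; exists z.
have le_f x c : (forall z, eball rho z -> c <= g z + K * enorm (x - z)) -> c <= f x.
  by move=> H; apply: lb_le_inf => // _ [z zr <-]; exact: H.
have fK : elip K f.
  suff H x y : f x <= f y + K * enorm (x - y).
    move=> x y; rewrite ler_norml; apply/andP; split; last by rewrite lerBlDl.
    by rewrite lerNl opprB lerBlDl enormBC.
  rewrite -lerBlDr; apply: le_f => z zr; rewrite lerBlDr.
  apply: le_trans (f_le x z zr) _; rewrite -addrA lerD2l -mulrDr ler_wpM2l //.
  by rewrite [leRHS]addrC -(subrKA y x (- z)) enormD.
exists f; split => //.
- move=> x y t /[dup] t01 /andP[t0 t1].
  have t1' : 0 < 1 - t by rewrite subr_gt0.
  have H u v : eball rho u -> eball rho v -> f (t *: x + (1 - t) *: y) <=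
      t * (g u + K * enorm (x - u)) + (1 - t) * (g v + K * enorm (y - v)).
    move=> ur vr; set w := t *: u + (1 - t) *: v.
    have wr : eball rho w.
      rewrite /eball /=; apply: le_lt_trans (enormD _ _) _.
      rewrite !enormZ !gtr0_norm //.
      have -> : rho = t * rho + (1 - t) * rho by ring.
      by apply: ltrD; rewrite ltr_pM2l.
    have gw : g w <= t * g u + (1 - t) * g v.
      by have := phic u v t t01; rewrite !gE // -!EFinM -EFinD lee_fin.
    apply: le_trans (f_le _ _ wr) _.
    have : K * enorm (t *: x + (1 - t) *: y - w) <=
        K * (t * enorm (x - u) + (1 - t) * enorm (y - v)).
      rewrite ler_wpM2l //.
      have -> : t *: x + (1 - t) *: y - w = t *: (x - u) + (1 - t) *: (y - v).
        by apply/rowP => i; rewrite !mxE; ring.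
      by apply: le_trans (enormD _ _) _; rewrite !enormZ !gtr0_norm.
    lra.
  (* Take the infimum over u, then over v. *)
  have H1 v : eball rho v -> f (t *: x + (1 - t) *: y) <=
      t * f x + (1 - t) * (g v + K * enorm (y - v)).
    move=> vr; rewrite -lerBlDr [leRHS]mulrC -ler_pdivrMr //.
    apply: le_f => u ur; rewrite ler_pdivrMr // lerBlDr [X in _ <= X + _]mulrC.
    exact: H.
  rewrite -lerBlDl [leRHS]mulrC -ler_pdivrMr //.
  apply: le_f => v vr; rewrite ler_pdivrMr // lerBlDl [X in _ <= _ + X]mulrC; exact: H1.
- move=> x xr; rewrite gE //; congr EFin; apply/eqP; rewrite eq_le.
  apply/andP; split.
    apply: le_f => z zr; have := phiK _ _ xr zr.
    by rewrite ler_norml -/(g x) -/(g z) => /andP[_]; rewrite lerBlDl.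
  by apply: le_trans (f_le x x xr) _; rewrite subrr enorm0 mulr0 addr0.
Qed.

End extension.

(** * Optimality of the potentials *)

Section optimality.
Context {R : realType} {d : nat}.
Variables (rho r : R) (r_gt0 : 0 < r) (r_lt_rho : r < rho).
Local Open Scope ereal_scope.

Let rho_ge0 : (0 <= rho)%R. Proof. by apply: ltW; exact: lt_trans r_lt_rho. Qed.

Let eball_cball : (eball r : set 'rV[R]_d) `<=` cball rho.
Proof. by move=> x xr; apply: ltW; apply: lt_trans r_lt_rho. Qed.

Lemma integral_EFin_Rintegral disp (T : measurableType disp)
    (mu : {measure set T -> \bar R}) (f : T -> R) :
  mu.-integrable setT (EFin \o f) ->
  \int[mu]_x (f x)%:E = (\int[mu]_x f x)%R%:E.
Proof. by move=> fi; rewrite /Rintegral fineK //; exact: integrable_fin_num. Qed.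

(** Optimality of [f] tested against the conjugate of the average of the two
    dual potentials. As [x] is the midpoint of [x - v] and [x + v], this
    competitor is at most the average of [f (x - v)] and [g (x + v)] at [x],
    and its own conjugate is at most the average of the dual potentials. *)
Lemma optimality_midpoint (mu nu : probability (Rd R d) R)
    (f g : 'rV[R]_d -> R) (K L : R) (u : 'rV[R]_d -> R) :
  mu (~` eball r) = 0 -> nu (~` eball r) = 0 ->
  optimal_brenier_potential mu nu (EFin \o f) ->
  (0 <= K)%R -> (0 <= L)%R -> elip K f -> elip L g ->
  mu.-integrable setT (EFin \o (u : Rd R d -> R)) ->
  (forall x, eball r x -> exists v,
    [/\ cball rho (x - v), cball rho (x + v) & u x = f (x - v) + g (x + v)]%R) ->
  (2 * \int[mu]_x f x + \int[nu]_y pconj rho f y <=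
   \int[mu]_x u x + \int[nu]_y pconj rho g y)%R.
Proof.
move=> mur nur [_ Fopt] K0 L0 fK gL ui uE.
have p0L := pconj_elip _ rho_ge0 _ _ fK K0.
have p1L := pconj_elip _ rho_ge0 _ _ gL L0.
have ip0 := integrable_elip _ _ _ _ rho_ge0 nur p0L.
have ip1 := integrable_elip _ _ _ _ rho_ge0 nur p1L.
have if0 := integrable_elip _ _ _ _ K0 mur fK.
pose q y := (2^-1 * (pconj rho f y + pconj rho g y))%R.
pose phi := conjugate (EFin \o q).
have phi_le x : eball r x -> phi x <= (2^-1 * u x)%:E.
  move=> /uE[v [xv1 xv2 ->]]; apply: ge_ereal_sup => _ [y _ <-].
  rewrite /= -EFinD lee_fin /q dotC.
  have := pconj_ub _ _ _ _ y fK K0 xv1; have := pconj_ub _ _ _ _ y gL L0 xv2.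
  rewrite !dotDl dotNl; lra.
have phiG : Gamma0 phi.
  apply: conjugate_EFin_Gamma0; exists 0%R.
  by apply: le_lt_trans (phi_le _ _) (ltry _); rewrite /eball /= enorm0.
have isum : nu.-integrable setT
    (EFin \o (fun y : Rd R d => pconj rho f y + pconj rho g y)%R).
  exact: (integrableD measurableT ip0 ip1).
have iq : nu.-integrable setT (EFin \o (q : Rd R d -> R)).
  exact: (integrableZl measurableT 2^-1 isum).
have iu2 : mu.-integrable setT (EFin \o (fun x : Rd R d => 2^-1 * u x)%R).
  exact: (integrableZl measurableT 2^-1 ui).
have : brenier_functional mu nu (EFin \o f) <= brenier_functional mu nu phi.
  by rewrite Fopt; apply: ereal_inf_lbound; exists phi.
have le1 : (\int[mu]_x f x)%R%:E + (\int[nu]_y pconj rho f y)%R%:E <=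
    brenier_functional mu nu (EFin \o f).
  rewrite -!integral_EFin_Rintegral //; apply: leeD => //.
  by apply: integral_mono => y _; exact: pconj_le_conjugate.
have le2 : brenier_functional mu nu phi <=
    (\int[mu]_x (2^-1 * u x))%R%:E + (\int[nu]_y q y)%R%:E.
  rewrite -!integral_EFin_Rintegral //; apply: leeD.
    apply: (le_integral_concentrated mu _ (measurable_eball r) mur) phi_le.
      by apply: measurable_lsc; case: phiG.
    by case/integrableP : iu2.
  by apply: integral_mono => y _; exact: conjugate_conjugate_le.
move=> /(le_trans le1)/le_trans/(_ le2).
rewrite -!EFinD lee_fin RintegralZl // RintegralZl //.
rewrite RintegralD //; lra.
Qed.

(** Optimality of [phi0] tested against the truncation of [f]. Truncating
    [phi0] as well lowers its conjugate and does not change it on the ball that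
    carries [mu], whence a comparison of truncated conjugates only. *)
Lemma optimality_trunc (mu nu : probability (Rd R d) R)
    (phi0 : 'rV[R]_d -> \bar R) (f g : 'rV[R]_d -> R) (K L : R) :
  mu (~` eball r) = 0 -> nu (~` eball r) = 0 ->
  optimal_brenier_potential mu nu phi0 ->
  (0 <= K)%R -> (0 <= L)%R -> elip K f -> rconvex f -> elip L g ->
  (forall x, cball rho x -> phi0 x = (g x)%:E) ->
  (\int[mu]_x g x + \int[nu]_y pconj rho g y <=
   \int[mu]_x f x + \int[nu]_y pconj rho f y)%R.
Proof.
move=> mur nur [[_ lsc0 _] Fopt] K0 L0 fK fc gL phig.
have p0L := pconj_elip _ rho_ge0 _ _ fK K0.
have p1L := pconj_elip _ rho_ge0 _ _ gL L0.
have ip0 := integrable_elip _ _ _ _ rho_ge0 nur p0L.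
have ip1 := integrable_elip _ _ _ _ rho_ge0 nur p1L.
have if0 := integrable_elip _ _ _ _ K0 mur fK.
have ig0 := integrable_elip _ _ _ _ L0 mur gL.
have tG := trunc_Gamma0 _ rho_ge0 _ _ fK fc.
have : brenier_functional mu nu phi0 <= brenier_functional mu nu (trunc rho f).
  by rewrite Fopt; apply: ereal_inf_lbound; exists (trunc rho f).
have le1 : (\int[mu]_x g x)%R%:E + (\int[nu]_y pconj rho g y)%R%:E <=
    brenier_functional mu nu phi0.
  rewrite -!integral_EFin_Rintegral //; apply: leeD.
    apply: (le_integral_concentrated mu _ (measurable_eball r) mur).
    + by case/integrableP : ig0.
    + exact: measurable_lsc.
    + by move=> x /eball_cball /phig ->.
  by apply: integral_mono => y _; exact: pconj_le_conjugate.
have le2 : brenier_functional mu nu (trunc rho f) <=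
    (\int[mu]_x f x)%R%:E + (\int[nu]_y pconj rho f y)%R%:E.
  rewrite -!integral_EFin_Rintegral //; apply: leeD.
    apply: (le_integral_concentrated mu _ (measurable_eball r) mur).
    + by apply: measurable_lsc; case: tG.
    + by case/integrableP : if0.
    + by move=> x /eball_cball xr; rewrite /trunc ifT.
  by apply: integral_mono => y _; exact: conjugate_trunc fK K0.
by move=> /(le_trans le1)/le_trans/(_ le2); rewrite -!EFinD lee_fin.
Qed.

End optimality.

(** * Partial derivatives of convex functions *)

Section partial_derivatives.
Context {R : realType} {d : nat}.
Implicit Types (f : 'rV[R]_d -> R) (x v : 'rV[R]_d) (i : 'I_d).

Lemma rconvex_slope f x v s t : rconvex f -> 0 < s <= t ->
  t * (f (x + s *: v) - f x) <= s * (f (x + t *: v) - f x).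
Proof.
move=> fc /andP[s0]; rewrite le_eqVlt => /predU1P[->|st]; first by [].
have t0 : 0 < t by exact: lt_trans st.
have st01 : 0 < s / t < 1 by rewrite divr_gt0 // ltr_pdivrMr // mul1r.
have := fc (x + t *: v) x _ st01.
set A := f (x + t *: v); set B := f x.
have -> : (s / t) *: (x + t *: v) + (1 - s / t) *: x = x + s *: v.
  by apply/rowP => j; rewrite !mxE; field; rewrite gt_eqF.
move=> /(ler_wpM2l (ltW t0)).
have -> : t * (s / t * A + (1 - s / t) * B) = s * A + t * B - s * B.
  by field; rewrite gt_eqF.
lra.
Qed.

(** Written as in the definition of [derive], to which it is convertible. *)
Definition dquot f i x (s : R) : R := s^-1 * (f (s *: delta_mx ord0 i + x) - f x).

Lemma dquot_pos f i x s t : rconvex f -> 0 < s <= t ->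
  dquot f i x s <= dquot f i x t.
Proof.
move=> fc /[dup] /(rconvex_slope _ x (delta_mx ord0 i) _ _ fc) H /andP[s0 st].
have t0 : 0 < t by exact: lt_le_trans st.
by rewrite /dquot ler_pdivrMl // mulrCA ler_pdivlMl // ![_ + x]addrC.
Qed.

Lemma dquotN f i x s : dquot f i x (- s) =
  - (s^-1 * (f (x + s *: (- delta_mx ord0 i)) - f x)).
Proof. by rewrite /dquot invrN mulNr scalerN scaleNr [_ + x]addrC. Qed.

Lemma dquot_neg f i x s t : rconvex f -> 0 < s <= t ->
  dquot f i x (- t) <= dquot f i x (- s).
Proof.
move=> fc /[dup] /(rconvex_slope _ x (- delta_mx ord0 i) _ _ fc) H /andP[s0 st].
have t0 : 0 < t by exact: lt_le_trans st.
by rewrite !dquotN lerN2 ler_pdivrMl // mulrCA ler_pdivlMl.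
Qed.

Lemma sdiff_dquot f i x h : 0 < h ->
  sdiff f i h x = h * (dquot f i x h - dquot f i x (- h)).
Proof.
move=> h0; rewrite dquotN /dquot /sdiff scalerN [_ + x]addrC.
by field; rewrite gt_eqF.
Qed.

Lemma dquot_neg_pos f i x s t : rconvex f -> 0 < s -> 0 < t ->
  dquot f i x (- s) <= dquot f i x t.
Proof.
move=> fc s0 t0; set m := Num.min s t.
have m0 : 0 < m by rewrite lt_min s0.
apply: (@le_trans _ _ (dquot f i x (- m))).
  by apply: dquot_neg => //; rewrite m0 ge_min lexx.
apply: (@le_trans _ _ (dquot f i x m)).
  have := sdiff_ge0 f i m x fc; rewrite sdiff_dquot //.
  by rewrite pmulr_rge0 // subr_ge0.
by apply: dquot_pos => //; rewrite m0 ge_min lexx orbT.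
Qed.

(** Difference quotients are nondecreasing in the step, and the second
    difference with step [h], divided by [h], is the gap between those at [h]
    and [- h]. Once this gap is small, all quotients with smaller steps are
    trapped, so they converge. *)
Lemma sdiff_derivable f i x : rconvex f ->
  (forall e, 0 < e -> exists2 h, 0 < h & sdiff f i h x <= e * h) ->
  derivable f x (delta_mx ord0 i).
Proof.
move=> fc small; pose Q := [set dquot f i x s | s in [set s | 0 < s]].
have Q0 : Q !=set0 by exists (dquot f i x 1), 1 => //=.
have Qlb : has_lbound Q.
  exists (dquot f i x (- 1)) => _ [t /= t0 <-]; exact: dquot_neg_pos.
apply/cvg_ex; exists (inf Q); apply/cvgrPdist_le => e e0.
have [h h0 hs] := small e e0.
apply/nbhs_ballP; exists h => //= s; rewrite /ball /= sub0r normrN => sh s0.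
have Qh : dquot f i x (- h) <= inf Q <= dquot f i x h.
  apply/andP; split; last by apply: ge_inf => //; exists h.
  by apply: lb_le_inf => // _ [t /= t0 <-]; exact: dquot_neg_pos.
have sQ : dquot f i x (- h) <= dquot f i x s <= dquot f i x h.
  move: s0 sh; case: (ltgtP s 0) => // s0 _.
    rewrite ltr0_norm // => sh; have s0' : 0 < - s by rewrite oppr_gt0.
    rewrite -[s]opprK; apply/andP; split; last exact: dquot_neg_pos.
    by apply: dquot_neg => //; rewrite s0' ltW.
  rewrite gtr0_norm // => sh; rewrite dquot_neg_pos //=.
  by apply: dquot_pos => //; rewrite s0 ltW.
have {hs} : dquot f i x h - dquot f i x (- h) <= e.
  by move: hs; rewrite sdiff_dquot // mulrC ler_pM2r.
move: Qh sQ => /andP[q1 q2] /andP[q3 q4] q5.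
change (`|inf Q - dquot f i x s| <= e).
rewrite ler_norml; apply/andP; split; lra.
Qed.

Lemma derivable_dquot f i x : derivable f x (delta_mx ord0 i) ->
  dquot f i x s @[s --> 0^'] --> 'D_(delta_mx ord0 i) f x.
Proof. by []. Qed.

(** The subgradient inequality along one axis, for steps of both signs. *)
Lemma derive_le_dquot f i x h : rconvex f -> 0 < h ->
  derivable f x (delta_mx ord0 i) ->
  dquot f i x (- h) <= 'D_(delta_mx ord0 i) f x <= dquot f i x h.
Proof.
move=> fc h0 /derivable_dquot /cvgrPdist_le cD.
have near0 e : 0 < e -> exists s, [/\ 0 < s <= h,
    `|'D_(delta_mx ord0 i) f x - dquot f i x s| <= e &
    `|'D_(delta_mx ord0 i) f x - dquot f i x (- s)| <= e].
  move=> /cD /nbhs_ballP[e' /= e'0 He].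
  have s0 : 0 < Num.min h (e' / 2) by rewrite lt_min h0 divr_gt0.
  have se : Num.min h (e' / 2) < e'.
    by rewrite gt_min ltr_pdivrMr // ltr_pMr // ltr1n orbT.
  exists (Num.min h (e' / 2)); split; first by rewrite s0 ge_min lexx.
  - by apply: He; rewrite /ball /= ?sub0r ?normrN ?gtr0_norm // gt_eqF.
  - apply: He; first by rewrite /ball /= sub0r opprK gtr0_norm.
    by rewrite oppr_eq0 gt_eqF.
apply/andP; split; apply/ler_addgt0Pr => e /near0[s [sh]].
- move=> _; have := dquot_neg f i x s h fc sh.
  rewrite ler_norml => Q /andP[+ _]; lra.
- move=> + _; have := dquot_pos f i x s h fc sh.
  rewrite ler_norml => Q /andP[_]; lra.
Qed.

Lemma abs_derive_le K f i x : elip K f -> rconvex f ->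
  derivable f x (delta_mx ord0 i) -> `|'D_(delta_mx ord0 i) f x| <= K.
Proof.
move=> fK fc /(derive_le_dquot f i x 1 fc ltr01) /andP[D1 D2].
have := fK (1 *: delta_mx ord0 i + x) x.
have := fK (- 1 *: delta_mx ord0 i + x) x.
rewrite !addrK !enormZ enorm_delta normrN normr1 !mulr1 !ler_norml.
move: D1 D2; rewrite /dquot invrN invr1 mulN1r mul1r.
move=> ? ? /andP[? ?] /andP[? ?]; apply/andP; split; lra.
Qed.

End partial_derivatives.

(** * Estimates off a null set *)

Section almost_everywhere.
Context {R : realType} {d : nat}.
Local Open Scope ereal_scope.
Import HBNNSimple.

(** Meant for [f] the norm of a difference of gradients, which take default
    values where a partial derivative does not exist. Simple functions below
    [f] may be cut off outside [B] without changing their integrals. *)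
Lemma ge0_integral_le_concentrated disp (T : measurableType disp)
    (P : probability T R) (B : set T) (f g : T -> \bar R) :
  measurable B -> P (~` B) = 0 -> (forall x, 0 <= f x) ->
  measurable_fun setT g -> (forall x, B x -> f x <= g x) ->
  \int[P]_x f x <= \int[P]_x g x.
Proof.
move=> mB PB f0 mg fg; rewrite ge0_integralTE // (integral_concentrated P _ mB PB) //.
apply: ge_ereal_sup => _ [h /= hf <-].
rewrite -integralT_nnsfun (integral_concentrated P _ mB PB); last exact/measurable_EFinP.
by apply: integral_mono => x Bx; apply: le_trans (hf x) (fg x Bx).
Qed.

Lemma chebyshev_ge0 disp (T : measurableType disp) (mu : {measure set T -> \bar R})
    (g : T -> R) (a : R) : measurable_fun setT g -> (forall x, (0 <= g x)%R) ->
  a%:E * mu [set x | (a < g x)%R] <= \int[mu]_x (g x)%:E.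
Proof.
move=> mg g0; set A := [set x | _].
have mA : measurable A.
  rewrite -[A]setTI; apply: (mg measurableT [set t | (a < t)%R]).
  by apply: open_measurable; exact: open_gt.
rewrite -integral_cst //; apply: (@le_trans _ _ (\int[mu]_(x in A) (g x)%:E)).
  by apply: integral_mono => x Ax; rewrite lee_fin ltW.
apply: ge0_subset_integral => //; first exact/measurable_EFinP.
by move=> x _; rewrite lee_fin.
Qed.

Lemma exists_natSinv_lt (e : R) : (0 < e)%R -> exists n, (n.+1%:R^-1 < e)%R.
Proof.
move=> e0; have [n _ /(_ n (leqnn n))] := near_infty_natSinv_lt (PosNum e0).
by exists n.
Qed.

(** By Chebyshev, the second difference with step [h] exceeds [e * h] only on a
    set of measure [O(h / e)]. So it does for all small [h] only on a null
    set, and elsewhere [sdiff_derivable] applies. *)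
Lemma derivable_off_null (mu : probability (Rd R d) R) (M r K : R)
    (f : 'rV[R]_d -> R) i :
  (0 < M)%R -> (0 < r)%R -> elip K f -> rconvex f ->
  mu (~` eball r) = 0 ->
  (forall A : set (Rd R d), measurable A -> mu A <= M%:E * lebesgue_rV A) ->
  exists N : set (Rd R d), [/\ measurable N, mu N = 0 &
    forall x : 'rV[R]_d, ~ N x -> derivable f x (delta_mx ord0 i)].
Proof.
move=> M0 r0 fK fc mu0 muM.
pose inv n : R := n.+1%:R^-1%R.
have inv0 n : (0 < inv n)%R by rewrite invr_gt0.
pose A k n : set (Rd R d) := [set x | inv k * inv n < sdiff f i (inv n) x]%R.
have msd n : measurable_fun setT (sdiff f i (inv n) : Rd R d -> R).
  exact: measurable_sdiff fK.
have mA k n : measurable (A k n).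
  rewrite -[A k n]setTI; apply: (msd n measurableT [set t | (inv k * inv n < t)%R]).
  by apply: open_measurable; exact: open_gt.
have mAk k : measurable (\bigcap_n A k n) by apply: bigcap_measurable => // n _.
have Ak0 k : mu (\bigcap_n A k n) = 0.
  set C := (M * (2 * K * (2 * r) ^+ d.-1))%R.
  have le_n n : mu (\bigcap_n A k n) <= (C * k.+1%:R * inv n)%:E.
    apply: (@le_trans _ _ (mu (A k n))).
      by apply: le_measure; rewrite ?inE //; exact: bigcap_inf.
    have := le_trans (chebyshev_ge0 _ _ mu _ (inv k * inv n)%R (msd n)
      (fun x => sdiff_ge0 _ _ _ _ fc))
      (integral_sdiff_le mu M r K _ f i M0 r0 (inv0 n) fK fc mu0 muM).
    have -> : (M * (2 * K * (2 * r) ^+ d.-1) * inv n ^+ 2 =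
      (inv k * inv n) * (C * k.+1%:R * inv n))%R.
      have -> : k.+1%:R = (inv k)^-1%R by rewrite /inv invrK.
      rewrite /C; move: (inv0 k); move: (inv k) (inv n) => a b a0.
      by field; rewrite gt_eqF.
    by rewrite [X in _ <= X -> _]EFinM lee_pmul2l // lte_fin mulr_gt0.
  have : mu (\bigcap_n A k n) \is a fin_num by exact: fin_num_measure.
  have : 0 <= mu (\bigcap_n A k n) by exact: measure_ge0.
  move: le_n; case: (mu (\bigcap_n A k n)) => // m le_n m0 _; congr EFin.
  apply/eqP; rewrite eq_le -[X in _ && X]lee_fin m0 andbT.
  apply/ler_addgt0Pr => e e0; rewrite add0r.
  have C1 : (0 < `|C * k.+1%:R| + 1)%R by rewrite ltr_wpDl.
  have [n ne] := exists_natSinv_lt _ (divr_gt0 e0 C1).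
  have := le_n n; rewrite lee_fin => /le_trans; apply.
  apply: (@le_trans _ _ ((`|C * k.+1%:R| + 1) * inv n)%R).
    rewrite ler_pM2r //; apply: le_trans (ler_norm _) _; by rewrite lerDl.
  by rewrite mulrC -ler_pdivlMr // ltW.
exists (\bigcup_k \bigcap_n A k n); split.
- exact: bigcup_measurable.
- apply/negligibleP; first exact: bigcup_measurable.
  by apply: negligible_bigcup => k; apply/negligibleP => //; exact: Ak0.
- move=> x Nx; apply: sdiff_derivable => // e e0.
  have [k ke] := exists_natSinv_lt _ e0.
  have [n nx] : exists n, ~ A k n x.
    apply: contrapT => /forallNP H; apply: Nx; exists k => // n _.
    by apply: contrapT; exact: H.
  exists (inv n) => //; move/negP : nx; rewrite -leNgt => /le_trans; apply.
  by rewrite ler_pM2r // ltW.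
Qed.

Lemma wasserstein1_Rintegral (alpha beta : probability (Rd R d) R) (r K w : R)
    (f : 'rV[R]_d -> R) : (0 < K)%R ->
  alpha (~` eball r) = 0 -> beta (~` eball r) = 0 -> elip K f ->
  wasserstein1 alpha beta = w%:E ->
  (\int[alpha]_x f x <= \int[beta]_x f x + K * w)%R.
Proof.
move=> K0 ar br fK W; have := wasserstein1_elip _ _ _ _ _ K0 ar br fK.
have ia := integrable_elip _ _ _ _ (ltW K0) ar fK.
have ib := integrable_elip _ _ _ _ (ltW K0) br fK.
rewrite W (integral_EFin_Rintegral _ _ _ _ ia) (integral_EFin_Rintegral _ _ _ _ ib).
by rewrite -EFinM -EFinD lee_fin.
Qed.

Lemma elipB (K L : R) (f g : 'rV[R]_d -> R) : elip K f -> elip L g ->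
  elip (K + L)%R (fun x => f x - g x)%R.
Proof.
move=> fK gL x y; have := fK x y; have := gL x y; rewrite mulrDl => ? ?.
have -> : (f x - g x - (f y - g y) = (f x - f y) - (g x - g y))%R by ring.
by apply: le_trans (ler_normB _ _) _; exact: lerD.
Qed.

End almost_everywhere.

(** * The estimate of gradients *)

Section step_choice.
Context {R : realType}.

(** The step [h = sqrt w] balances [w / h] and [h]; the bound [D * b] takes over
    when [w] is too large for that step to be allowed, and [w = 0] requires to
    let [h] tend to [0]. *)
Lemma optimize_step (X : \bar R) (D a C b r w : R) :
  0 < r -> 0 <= w -> 0 <= D -> 0 <= a -> 0 <= C -> 0 <= b ->
  (forall h, 0 < h <= r / 2 -> (X <= (D * (a * w / h + C * h))%:E)%E) ->
  (X <= (D * b)%:E)%E ->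
  (X <= (D * ((a + C) * (1 + r / 2) + b * (1 + 2 / r)) * w `^ 4^-1)%:E)%E.
Proof.
move=> r0 w0 D0 a0 C0 b0 Xh Xb.
have [w_eq0|wneq0] := eqVneq w 0.
  rewrite w_eq0 powR0 ?invr_eq0 // mulr0.
  apply/lee_addgt0Pr => e e0; rewrite add0e.
  have DC : 0 < D * C + 1 by rewrite ltr_wpDl ?mulr_ge0.
  have h0 : 0 < Num.min (r / 2) (e / (D * C + 1)) by rewrite lt_min !divr_gt0.
  apply: le_trans (Xh (Num.min (r / 2) (e / (D * C + 1))) _) _.
    by rewrite h0 ge_min lexx.
  rewrite w_eq0 mulr0 mul0r add0r lee_fin.
  apply: (@le_trans _ _ ((D * C + 1) * (e / (D * C + 1)))).
    rewrite mulrA ler_pM ?mulr_ge0 ?(ltW h0) //; first by rewrite lerDl.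
    by rewrite ge_min lexx orbT.
  by rewrite mulrC divfK ?gt_eqF.
have wp : 0 < w by rewrite lt_neqAle eq_sym wneq0.
set q := w `^ 4^-1; have q0 : 0 < q by rewrite powR_gt0.
have qw : q ^+ 4 = w.
  by rewrite -powR_mulrn ?(ltW q0) // -powRrM mulVf // powRr1.
have a1 : 0 <= (a + C) by exact: addr_ge0.
have rV : 0 < 2 / r by rewrite divr_gt0.
(* Here q ^+ 2 is sqrt w, the optimal step. *)
have [qr|rq] := leP (q ^+ 2) (r / 2).
  have q20 : 0 < q ^+ 2 by rewrite exprn_gt0.
  apply: le_trans (Xh (q ^+ 2) _) _; first by rewrite q20.
  rewrite lee_fin -[leRHS]mulrA ler_wpM2l // -qw.
  have -> : a * q ^+ 4 / q ^+ 2 + C * q ^+ 2 = (a + C) * q * q.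
    by field; rewrite gt_eqF.
  rewrite [leRHS]mulrDl -[leLHS]addr0; apply: lerD; last first.
    by rewrite !mulr_ge0 ?(ltW q0) // addr_ge0 // ltW.
  rewrite ler_wpM2r ?(ltW q0) // ler_wpM2l //; nra.
apply: le_trans Xb _; rewrite lee_fin -[leRHS]mulrA ler_wpM2l //.
rewrite [leRHS]mulrDl -[leLHS]add0r; apply: lerD.
  by rewrite !mulr_ge0 ?(ltW q0) // addr_ge0 // divr_ge0 // ltW.
rewrite -mulrA -[leLHS]mulr1 ler_wpM2l //.
have qr' : 1 <= 2 / r * q ^+ 2.
  by rewrite mulrAC ler_pdivlMr // mul1r; lra.
have [q1|q1] := leP 1 q; nra.
Qed.

End step_choice.

Section axis_estimate.
Context {R : realType} {d : nat}.
Implicit Types (f g : 'rV[R]_d -> R) (i : 'I_d) (h : R) (x : 'rV[R]_d).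

Lemma elipD K L f g : elip K f -> elip L g -> elip (K + L) (fun x => f x + g x).
Proof.
move=> fK gL x y; have := fK x y; have := gL x y; rewrite mulrDl => ? ?.
by rewrite opprD addrACA; apply: le_trans (ler_normD _ _) _; exact: lerD.
Qed.

Lemma elip_min K f g : elip K f -> elip K g ->
  elip K (fun x => Num.min (f x) (g x)).
Proof.
move=> fK gK x y; have := fK x y; have := gK x y.
rewrite !ler_norml => /andP[? ?] /andP[? ?].
by apply/andP; split; case: (leP (f x) (g x)) => ?; case: (leP (f y) (g y)) => ?; lra.
Qed.

Lemma elip_sdiff K f i h : elip K f -> elip (K + K + (K + K)) (sdiff f i h).
Proof.
move=> fK; have := elipB _ _ _ _ (elipD _ _ _ _ (elip_shift _ _ (h *: delta_mx ord0 i) fK)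
  (elip_shift _ _ (- (h *: delta_mx ord0 i)) fK)) (elipD _ _ _ _ fK fK).
rewrite (_ : (fun _ => _) = sdiff f i h) //.
by apply/funext => x; rewrite /sdiff mulr_natl mulr2n.
Qed.

Definition swap_min f g i h x : R :=
  Num.min (f (x - h *: delta_mx ord0 i) + g (x + h *: delta_mx ord0 i))
          (f (x + h *: delta_mx ord0 i) + g (x - h *: delta_mx ord0 i)).

Lemma elip_swap_min K L f g i h : elip K f -> elip L g ->
  elip (K + L) (swap_min f g i h).
Proof.
by move=> fK gL; apply: elip_min; apply: elipD; exact: elip_shift.
Qed.

(** A Lipschitz, hence measurable and integrable, majorant of [h] times the
    distance between the i-th partial derivatives of [f] and [g], wherever
    these exist. *)
Definition axis_gap f g i h x : R :=
  f x + g x - swap_min f g i h x + sdiff f i h x + sdiff g i h x.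

Lemma axis_gap_ge0 f g i h x : rconvex f -> rconvex g -> 0 <= axis_gap f g i h x.
Proof.
move=> fc gc; have sf := sdiff_ge0 f i h x fc; have sg := sdiff_ge0 g i h x gc.
rewrite /axis_gap /swap_min; move: sf sg; rewrite /sdiff.
move: (f (x + _)) (f (x - _)) (g (x + _)) (g (x - _)) => a b c e sf sg.
by case: (leP (b + c) (a + e)) => ?; lra.
Qed.

(** The sign of the difference of the partial derivatives tells which of the two
    sums in [swap_min] to use. There the gradient inequality holds in the wrong
    direction, and replacing [f (x - v)] by [2 * f x - f (x + v)], and likewise
    for [g], corrects this at the price of the second differences. *)
Lemma partial_gap f g i h x : rconvex f -> rconvex g -> 0 < h ->
  derivable f x (delta_mx ord0 i) -> derivable g x (delta_mx ord0 i) ->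
  `|'D_(delta_mx ord0 i) f x - 'D_(delta_mx ord0 i) g x|
    <= h^-1 * axis_gap f g i h x.
Proof.
move=> fc gc h0 df dg; rewrite ler_pdivlMl // -{1}(gtr0_norm h0) -normrM.
have bounds e : rconvex e -> derivable e x (delta_mx ord0 i) ->
    e x - e (x - h *: delta_mx ord0 i) <= h * 'D_(delta_mx ord0 i) e x
      <= e (x + h *: delta_mx ord0 i) - e x.
  move=> ec de; have := derive_le_dquot e i x h ec h0 de.
  rewrite dquotN scalerN -mulrN opprB /dquot [_ + x]addrC.
  by rewrite ler_pdivrMl // ler_pdivlMl.
have [f1 f2] := andP (bounds f fc df); have [g1 g2] := andP (bounds g gc dg).
have sf := sdiff_ge0 f i h x fc; have sg := sdiff_ge0 g i h x gc.
move: sf sg f1 f2 g1 g2; rewrite mulrBr /axis_gap /swap_min /sdiff.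
move: (h * _) (h * _) (f (x + _)) (f (x - _)) (g (x + _)) (g (x - _)).
move=> a b f1 f2 g1 g2 ? ? ? ? ? ?.
rewrite ler_norml; apply/andP; split; 
  case: (leP (f2 + g1) (f1 + g2)) => ?; lra.
Qed.

End axis_estimate.

Section main_estimate.
Context {R : realType} {d : nat}.
Variables (r M : R) (r_gt0 : 0 < r) (M_gt0 : 0 < M).
Variables (mu nu muh nuh : probability (Rd R d) R).
Hypotheses (mur : mu (~` eball r) = 0%E) (nur : nu (~` eball r) = 0%E).
Hypotheses (muhr : muh (~` eball r) = 0%E) (nuhr : nuh (~` eball r) = 0%E).
Hypothesis muM : forall A : set (Rd R d), measurable A ->
  (mu A <= M%:E * lebesgue_rV A)%E.
Variables (f g : 'rV[R]_d -> R) (phi0 : 'rV[R]_d -> \bar R).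
Hypotheses (fL : elip r f) (fc : rconvex f).
Hypotheses (gL : elip (2 * r) g) (gc : rconvex g).
Hypothesis phi0g : forall x, eball (2 * r) x -> phi0 x = (g x)%:E.
Hypothesis fopt : optimal_brenier_potential mu nu (EFin \o f).
Hypothesis phi0opt : optimal_brenier_potential muh nuh phi0.
Variables (w1 w2 : R).
Hypotheses (W1 : wasserstein1 mu muh = w1%:E) (W2 : wasserstein1 nu nuh = w2%:E).

Let r_ge0 : 0 <= r. Proof. exact: ltW. Qed.
Let r2_ge0 : 0 <= 2 * r. Proof. by rewrite mulr_ge0. Qed.

(* Steps h up to r / 2 from the ball of radius r stay in the ball of radius
   rho, which lies in the ball of radius 2 * r where phi0 is controlled. *)
Let rho := 3 / 2 * r.
Let r_rho : r < rho. Proof. by have := r_gt0; rewrite /rho; lra. Qed.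
Let rho_ge0 : 0 <= rho. Proof. exact: ltW (lt_trans r_gt0 r_rho). Qed.

Let cball_eball (x : 'rV[R]_d) : cball rho x -> eball (2 * r) x.
Proof.
by move=> xr; apply: le_lt_trans xr _; have := r_gt0; rewrite /rho; lra.
Qed.

(** By [optimality_trunc] the inequality holds without error term for the
    perturbed measures. Going back to [(mu, nu)] costs the Wasserstein distances
    times the Lipschitz constants of [g - f] and of the difference of the
    truncated conjugates, both equal to [3 * r]. *)
Lemma duality_gap :
  \int[mu]_x g x + \int[nu]_y pconj rho g y <=
  \int[mu]_x f x + \int[nu]_y pconj rho f y + 3 * r * (w1 + w2).
Proof.
have r0 := r_gt0; have pfL := pconj_elip _ rho_ge0 _ _ fL r_ge0.
have pgL := pconj_elip _ rho_ge0 _ _ gL r2_ge0.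
have phig x : cball rho x -> phi0 x = (g x)%:E by move=> /cball_eball; exact: phi0g.
have hat := optimality_trunc _ _ r_gt0 r_rho _ _ _ _ _ _ _ muhr nuhr phi0opt
  r_ge0 r2_ge0 fL fc gL phig.
have gf0 : 0 < 2 * r + r by lra.
have p0 : 0 < rho + rho by rewrite /rho; lra.
have := wasserstein1_Rintegral _ _ _ _ _ _ gf0 mur muhr (elipB _ _ _ _ gL fL) W1.
have := wasserstein1_Rintegral _ _ _ _ _ _ p0 nur nuhr (elipB _ _ _ _ pgL pfL) W2.
have i1 := integrable_elip _ _ _ _ r_ge0 mur fL.
have i2 := integrable_elip _ _ _ _ r2_ge0 mur gL.
have i3 := integrable_elip _ _ _ _ r_ge0 muhr fL.
have i4 := integrable_elip _ _ _ _ r2_ge0 muhr gL.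
have i5 := integrable_elip _ _ _ _ rho_ge0 nur pfL.
have i6 := integrable_elip _ _ _ _ rho_ge0 nur pgL.
have i7 := integrable_elip _ _ _ _ rho_ge0 nuhr pfL.
have i8 := integrable_elip _ _ _ _ rho_ge0 nuhr pgL.
rewrite !RintegralB //.
have -> : rho + rho = 3 * r by rewrite /rho; field.
have -> : 2 * r + r = 3 * r by ring.
lra.
Qed.

Let C := M * (6 * r * (2 * r) ^+ d.-1).

(** Optimality of [f] bounds the integral of [swap_min] from below, with
    [v = h e_i] or [v = - h e_i] according to where the minimum is attained. *)
Lemma integral_axis_gap i h : 0 < h <= r / 2 ->
  \int[mu]_x axis_gap f g i h x <= 3 * r * (w1 + w2) + C * h ^+ 2.
Proof.
move=> /andP[h0 hr]; have r0 := r_gt0.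
have uL := elip_swap_min _ _ _ _ i h fL gL.
have sfL := elip_sdiff _ _ i h fL; have sgL := elip_sdiff _ _ i h gL.
have k1 : 0 <= r + 2 * r by lra.
have k2 : 0 <= r + r + (r + r) by lra.
have k3 : 0 <= 2 * r + 2 * r + (2 * r + 2 * r) by lra.
have iu := integrable_elip _ _ _ _ k1 mur uL.
have isf := integrable_elip _ _ _ _ k2 mur sfL.
have isg := integrable_elip _ _ _ _ k3 mur sgL.
have i_f := integrable_elip _ _ _ _ r_ge0 mur fL.
have i_g := integrable_elip _ _ _ _ r2_ge0 mur gL.
have ifg : mu.-integrable setT (EFin \o (fun x : Rd R d => f x + g x)).
  exact: (integrableD measurableT i_f i_g).
have ifgu : mu.-integrable setT
    (EFin \o (fun x : Rd R d => f x + g x - swap_min f g i h x)).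
  exact: (integrableB measurableT ifg iu).
have ifgus : mu.-integrable setT (EFin \o (fun x : Rd R d =>
    f x + g x - swap_min f g i h x + sdiff f i h x)).
  exact: (integrableD measurableT ifgu isf).
rewrite /axis_gap RintegralD // RintegralD // RintegralB // RintegralD //.
have Isf := integral_sdiff_le _ _ _ _ _ _ i M_gt0 r_gt0 h0 fL fc mur muM.
have Isg := integral_sdiff_le _ _ _ _ _ _ i M_gt0 r_gt0 h0 gL gc mur muM.
move: Isf; rewrite (integral_EFin_Rintegral _ _ _ _ isf) lee_fin => Isf.
move: Isg; rewrite (integral_EFin_Rintegral _ _ _ _ isg) lee_fin => Isg.
have step x : eball r x -> exists v, [/\ cball rho (x - v), cball rho (x + v) &
    swap_min f g i h x = f (x - v) + g (x + v)].
  move=> xr; have ball v : enorm v = h -> cball rho (x + v).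
    move=> vh; apply: le_trans (enormD _ _) _; rewrite vh /rho.
    by move: xr; rewrite /eball /=; lra.
  have v1 : enorm (h *: delta_mx ord0 i : 'rV[R]_d) = h.
    by rewrite enormZ enorm_delta mulr1 gtr0_norm.
  have b1 := ball _ v1; have b2 := ball _ (etrans (enormN _) v1).
  rewrite /swap_min; case: leP => _; first by exists (h *: delta_mx ord0 i).
  by exists (- (h *: delta_mx ord0 i)); rewrite opprK.
have := optimality_midpoint _ _ r_gt0 r_rho _ _ _ _ _ _ _ mur nur fopt
  r_ge0 r2_ge0 fL gL iu step.
have := duality_gap.
have -> : C * h ^+ 2 = M * (2 * r * (2 * r) ^+ d.-1) * h ^+ 2 +
    M * (2 * (2 * r) * (2 * r) ^+ d.-1) * h ^+ 2 by rewrite /C; ring.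
lra.
Qed.

Lemma good_set : exists B : set (Rd R d), [/\ measurable B, mu (~` B) = 0%E,
  B `<=` eball r & forall (x : 'rV[R]_d) i, B x ->
    derivable f x (delta_mx ord0 i) /\ derivable g x (delta_mx ord0 i)].
Proof.
have null e K (i : 'I_d) : elip K e -> rconvex e -> exists N : set (Rd R d),
    [/\ measurable N, mu N = 0%E & forall x : 'rV[R]_d, ~ N x ->
     derivable e x (delta_mx ord0 i)].
  by move=> eK ec; exact: derivable_off_null mu M r K e i M_gt0 r_gt0 eK ec mur muM.
have [Nf Nf_] := boolp.choice (fun i => null f r i fL fc).
have [Ng Ng_] := boolp.choice (fun i => null g (2 * r) i gL gc).
pose N : set (Rd R d) := \big[setU/set0]_(i < d) (Nf i `|` Ng i).
have mN : measurable N.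
  apply: bigsetU_measurable => i _.
  by apply: measurableU; [case: (Nf_ i)|case: (Ng_ i)].
have N0 : mu.-negligible N.
  rewrite /N; elim/big_ind: _ => [|A B A0 B0|i _]; first exact: negligible_set0.
    exact: negligibleU.
  have [mf f0 _] := Nf_ i; have [mg g0 _] := Ng_ i.
  by apply: negligibleU; apply/negligibleP.
have mr : measurable (eball r : set (Rd R d)) by exact: measurable_eball.
exists (eball r `\` N); split.
- exact: measurableD.
- apply/negligibleP; first by apply: measurableC; exact: measurableD.
  rewrite setDE setCI setCK; apply: negligibleU => //.
  by apply/negligibleP => //; exact: measurableC.
- by move=> x [].
- move=> x i [_ Nx].
  have Nsub : Nf i `|` Ng i `<=` N.
    by rewrite /N (bigD1 i) //=; exact: subsetUl.
  by split; [case: (Nf_ i)|case: (Ng_ i)] => _ _; apply => ?;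
    apply: Nx; apply: Nsub; [left|right].
Qed.

Lemma enorm_grad_le (x : 'rV[R]_d) : eball r x ->
  enorm (grad f x - grad (fine \o phi0) x) <=
  \sum_(i < d) `|'D_(delta_mx ord0 i) f x - 'D_(delta_mx ord0 i) g x|.
Proof.
move=> xr; apply: le_trans (enorm_le_sum _) _; apply: ler_sum => i _.
rewrite !mxE (@near_eq_derive _ _ _ (fine \o phi0) g) //.
have : nbhs x (eball (2 * r)).
  apply: open_nbhs_nbhs; split; first exact: open_eball.
  by apply: lt_trans xr _; have := r_gt0; lra.
by apply: filterS => y /phi0g /= ->.
Qed.

(** The bound for large Wasserstein distances, by Lipschitz constants alone. *)
Lemma gradient_gap_trivial :
  (\int[mu]_x (enorm (grad f x - grad (fine \o phi0) x))%:E <=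
    (d%:R * (3 * r))%:E)%E.
Proof.
have [B [mB muB Br Bd]] := good_set.
apply: (@le_trans _ _ (\int[mu]_x (d%:R * (3 * r))%:E)%E); last first.
  by rewrite integral_cst // [X in (_ * X)%E]probability_setT mule1.
apply: (ge0_integral_le_concentrated _ _ mu B) => //.
  by move=> x; rewrite lee_fin enorm_ge0.
move=> x Bx; rewrite lee_fin; apply: le_trans (enorm_grad_le x (Br _ Bx)) _.
have -> : d%:R * (3 * r) = \sum_(i < d) 3 * r.
  by rewrite sumr_const card_ord mulr_natl.
apply: ler_sum => i _; have [df dg] := Bd x i Bx.
apply: le_trans (ler_normB _ _) _.
have := abs_derive_le _ _ _ _ fL fc df; have := abs_derive_le _ _ _ _ gL gc dg.
lra.
Qed.

Lemma gradient_gap h : 0 < h <= r / 2 ->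
  (\int[mu]_x (enorm (grad f x - grad (fine \o phi0) x))%:E <=
    (d%:R * (3 * r * (w1 + w2) / h + C * h))%:E)%E.
Proof.
move=> hr; have /andP[h0 _] := hr.
have [B [mB muB Br Bd]] := good_set.
have hV0 : 0 <= h^-1 by rewrite invr_ge0 ltW.
have gap0 i x : 0 <= h^-1 * axis_gap f g i h x.
  by rewrite mulr_ge0 // axis_gap_ge0.
have gapL i : elip (r + 2 * r + (r + 2 * r) + (r + r + (r + r)) +
    (2 * r + 2 * r + (2 * r + 2 * r))) (axis_gap f g i h).
  apply: elipD; last exact: elip_sdiff.
  apply: elipD; last exact: elip_sdiff.
  apply: elipB; first exact: elipD.
  exact: elip_swap_min.
have mgap i : measurable_fun setT (axis_gap f g i h : Rd R d -> R).
  exact: measurable_elip (gapL i).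
have igap i : mu.-integrable setT (EFin \o (axis_gap f g i h : Rd R d -> R)).
  by apply: integrable_elip mur (gapL i); have := r_gt0; lra.
apply: (@le_trans _ _
    (\int[mu]_x (\sum_(i < d) (h^-1 * axis_gap f g i h x)%:E))%E).
  apply: (ge0_integral_le_concentrated _ _ mu B) => //.
  - by move=> x; rewrite lee_fin enorm_ge0.
  - apply: emeasurable_sum => i; apply/measurable_EFinP.
    by apply: measurable_funM => //; exact: mgap.
  - move=> x Bx; rewrite sumEFin lee_fin.
    apply: le_trans (enorm_grad_le x (Br _ Bx)) _.
    by apply: ler_sum => i _; have [df dg] := Bd x i Bx; exact: partial_gap.
rewrite ge0_integral_sum //; last 2 first.
- by move=> i; apply/measurable_EFinP; apply: measurable_funM => //; exact: mgap.
- by move=> i x _; rewrite lee_fin gap0.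
have -> : d%:R * (3 * r * (w1 + w2) / h + C * h) =
    \sum_(i < d) (3 * r * (w1 + w2) / h + C * h).
  by rewrite sumr_const card_ord mulr_natl.
rewrite -sumEFin; apply: lee_sum => i _.
under eq_integral do rewrite EFinM.
rewrite ge0_integralZl_EFin //; last 2 first.
- by move=> x _; rewrite lee_fin axis_gap_ge0.
- by apply/measurable_EFinP; exact: mgap.
rewrite (integral_EFin_Rintegral _ _ _ _ (igap i)) -EFinM lee_fin ler_pdivrMl //.
apply: le_trans (integral_axis_gap i h hr) _; rewrite le_eqVlt; apply/orP; left.
by apply/eqP; field; rewrite gt_eqF.
Qed.

End main_estimate.

Theorem theorem3p6 (R : realType) (d : nat) (r M : R) (d_gt0 : (0 < d)%N)
    (r_gt0 : 0 < r) (M_gt0 : 0 < M) :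
  exists2 C : R, 0 < C &
  forall (mu nu : probability (Rd R d) R),
    compact (msupport mu) -> msupport mu `<=` eball r ->
    compact (msupport nu) -> msupport nu `<=` eball r ->
    (forall A : set (Rd R d), measurable A ->
       (mu A <= M%:E * lebesgue_rV A)%E) ->
  forall phibar : 'rV[R]_d -> \bar R,
    optimal_brenier_potential mu nu phibar ->
    elipschitz r [set: 'rV[R]_d] phibar ->
  forall (muh nuh : probability (Rd R d) R),
    muh (~` eball r) = 0%E -> nuh (~` eball r) = 0%E ->
  forall phi0 : 'rV[R]_d -> \bar R,
    optimal_brenier_potential muh nuh phi0 ->
    elipschitz (2 * r) (eball (2 * r)) phi0 ->
  (\int[mu]_x (enorm (grad (fine \o phibar) x - grad (fine \o phi0) x))%:E
    <= C%:E * (wasserstein1 mu muh + wasserstein1 nu nuh) `^ (4^-1)%R)%E.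
Proof.
pose C := M * (6 * r * (2 * r) ^+ d.-1).
have C0 : 0 <= C by rewrite /C !mulr_ge0 ?exprn_ge0 ?mulr_ge0 // ltW.
have r0 := r_gt0; have rV0 : 0 < 2 / r by rewrite divr_gt0.
pose D := d%:R * ((3 * r + C) * (1 + r / 2) + 3 * r * (1 + 2 / r)).
have D_gt0 : 0 < D.
  rewrite /D mulr_gt0 ?ltr0n // addr_gt0 // mulr_gt0 //; lra.
exists D => // mu nu _ /compl_eball_null mur _ /compl_eball_null nur muM.
move=> phibar phibar_opt [phibar_fin phibar_lip] muh nuh muhr nuhr phi0 phi0_opt
  phi0_lip.
pose f := fine \o phibar.
have phibarE : EFin \o f = phibar.
  by apply/funext => x; rewrite /f /= fineK // phibar_fin.
have fL : elip r f by move=> x y; exact: phibar_lip.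
have fc : rconvex f.
  have [[_ _ phic] _] := phibar_opt; move=> x y t /(phic x y).
  by rewrite -phibarE /= -!EFinM -EFinD lee_fin.
have [[_ _ phi0c] _] := phi0_opt.
have r20 : 0 < 2 * r by rewrite mulr_gt0.
have [g [gL gc gE]] := elip_extension _ _ _ r20 (ltW r20) phi0c phi0_lip.
have := wasserstein1_ge0 mu muh; have := wasserstein1_ge0 nu nuh.
(* If no coupling exists the distance is infinite, and so is the bound. *)
case W1 : (wasserstein1 mu muh) => [w1| |] //;
case W2 : (wasserstein1 nu nuh) => [w2| |] //; last 3 first.
- by move=> _ _; rewrite addey // poweRyr ?invr_eq0 // gt0_muley ?lte_fin // leey.
- by move=> _ _; rewrite addye // poweRyr ?invr_eq0 // gt0_muley ?lte_fin // leey.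
- by move=> _ _; rewrite addye // poweRyr ?invr_eq0 // gt0_muley ?lte_fin // leey.
rewrite !lee_fin => w20 w10; rewrite -EFinD poweR_EFin -EFinM.
have fopt : optimal_brenier_potential mu nu (EFin \o f) by rewrite phibarE.
apply: (optimize_step _ _ (3 * r) C (3 * r) r (w1 + w2)) => //.
- exact: addr_ge0.
- by rewrite mulr_ge0 // ltW.
- by rewrite mulr_ge0 // ltW.
- move=> h hr.
  exact: (gradient_gap _ _ r_gt0 M_gt0 _ _ _ _ mur nur muhr nuhr muM _ _ _
    fL fc gL gc gE fopt phi0_opt _ _ W1 W2).
- exact: (gradient_gap_trivial _ _ r_gt0 M_gt0 _ mur muM _ _ _ fL fc gL gc gE).
Qed.
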